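(* Let $\Phi$ and $\Psi$ be two ergodic graphings on a standard probability space $(X,\mu)$. Then every (abstract) group isomorphism between $[\Phi]_1$ and $[\Psi]_1$ is the conjugacy by some measure-preserving transformation: for every group isomorphism $\psi:[\Phi]_1\to[\Psi]_1$ there is $S\in\mathrm{Aut}(X,\mu)$ such that $\psi(T)=STS^{-1}$ for all $T\in[\Phi]_1$.
   Context: A standard probability space $(X,\mu)$ is a standard Borel space with a non-atomic Borel probability measure; everything is up to null sets. $\mathrm{Aut}(X,\mu)$ is the group of measure-preserving Borel bijections of $X$ modulo a.e. equality. A partial isomorphism is a measure-preserving Borel bijection $\varphi:\mathrm{dom}\,\varphi\to\mathrm{rng}\,\varphi$ between Borel subsets of $X$. A graphing $\Phi$ is a countable set of partial isomorphisms; it generates the equivalence relation $\mathcal R_\Phi$, the smallest one containing all $(x,\varphi(x))$ with $\varphi\in\Phi$, $x\in\mathrm{dom}\,\varphi$. $\Phi$ is ergodic if every Borel set that is a union of $\mathcal R_\Phi$-classes (up to null sets) has measure $0$ or $1$. On $\mathcal R_\Phi$-classes put $d_\Phi(x,y)=\min\{n:\exists\varphi_1,\dots,\varphi_n\in\Phi\cup\Phi^{-1},\ y=\varphi_n\cdots\varphi_1(x)\}$. The full group is $[\mathcal R_\Phi]=\{T\in\mathrm{Aut}(X,\mu):(x,T(x))\in\mathcal R_\Phi\text{ a.e.}\}$ and the $\mathrm L^1$ full group is $[\Phi]_1=\{T\in[\mathcal R_\Phi]:\int_Xd_\Phi(x,T(x))\,d\mu<+\infty\}$. *)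

(* Defs.v *)
From HB Require Import structures.
From Stdlib Require Import Relation_Operators.
From mathcomp Require Import all_boot all_order all_algebra.
From mathcomp Require Import generic_quotient.
From mathcomp Require Import all_classical all_reals all_analysis.

Set Implicit Arguments.
Unset Strict Implicit.
Unset Printing Implicit Defensive.

Import Order.TTheory GRing.Theory Num.Theory.

Local Open Scope classical_set_scope.
Local Open Scope ring_scope.
Local Open Scope ereal_scope.
Local Open Scope quotient_scope.

(* [X] is isomorphic to a complete separable metric space [M] equipped with
   its Borel sigma-algebra.  The library only packages completeness for pointed
   pseudometric spaces, so the Cauchy condition is spelled out. *)
Definition standard_borel (R : realType) (d : measure_display)
    (X : measurableType d) : Prop :=
  exists (M : metricType R) (f : X -> M),
    [/\ forall F : set_system M, ProperFilter F -> cauchy F ->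
          exists p : M, F --> p,
        exists2 D : set M, countable D & dense D,
        bijective f &
        forall A : set X,
          measurable A <-> exists2 B : set M, <<s open >> B & A = f @^-1` B].

Definition nonatomic (R : realType) (d : measure_display)
    (X : measurableType d) (mu : probability X R) : Prop :=
  forall A : set X, measurable A -> 0 < mu A ->
    exists B : set X, [/\ measurable B, B `<=` A, 0 < mu B & mu B < mu A].

(* A Borel bijection has a Borel inverse; for standard Borel spaces this is
   automatic (Lusin-Souslin), and here it is part of the definition. *)
Record mp_bijection (R : realType) (d : measure_display)
    (X : measurableType d) (mu : probability X R) := MPBijection {
  mp_fun :> X -> X ;
  mp_inv : X -> X ;
  mp_funK : cancel mp_fun mp_inv ;
  mp_invK : cancel mp_inv mp_fun ;
  measurable_mp_fun : measurable_fun [set: X] mp_fun ;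
  measurable_mp_inv : measurable_fun [set: X] mp_inv ;
  mp_preserving :
    forall A : set X, measurable A -> mu (mp_fun @^-1` A) = mu A }.

Section aut.
Context (R : realType) (d : measure_display) (X : measurableType d).
Variable mu : probability X R.
Local Notation mpb := (mp_bijection mu).

HB.instance Definition _ := gen_eqMixin mpb.
HB.instance Definition _ := gen_choiceMixin mpb.

Definition mp_id : mpb.
Proof. by exists id id. Defined.

Definition mp_comp (f g : mpb) : mpb.
Proof.
exists (f \o g) (mp_inv g \o mp_inv f).
- exact: can_comp (mp_funK f) (mp_funK g).
- exact: can_comp (mp_invK g) (mp_invK f).
- exact: measurableT_comp (measurable_mp_fun f) (measurable_mp_fun g).
- exact: measurableT_comp (measurable_mp_inv g) (measurable_mp_inv f).
- move=> A mA; rewrite comp_preimage mp_preserving ?mp_preserving//.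
  by rewrite -[X in measurable X]setTI; exact: measurable_mp_fun.
Defined.

Definition mp_invb (f : mpb) : mpb.
Proof.
exists (mp_inv f) (mp_fun f).
- exact: mp_invK.
- exact: mp_funK.
- exact: measurable_mp_inv.
- exact: measurable_mp_fun.
- move=> A mA; rewrite -[LHS](mp_preserving f).
    congr (mu _); apply/seteqP; split=> x /=; by rewrite mp_funK.
  by rewrite -[X in measurable X]setTI; exact: measurable_mp_inv.
Defined.

Definition mp_ae_eq (f g : mpb) : bool := `[< f = g %[ae mu] >].

Let mp_ae_eq_refl : reflexive mp_ae_eq.
Proof. by move=> f; apply/asboolP; exact: aeW. Qed.

Let mp_ae_eq_sym : symmetric mp_ae_eq.
Proof. by move=> f g; apply/idP/idP => /asboolP h; apply/asboolP; exact: ae_eq_sym. Qed.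

Let mp_ae_eq_trans : transitive mp_ae_eq.
Proof.
by move=> g f h /asboolP fg /asboolP gh; apply/asboolP; exact: ae_eq_trans fg gh.
Qed.

Canonical mp_ae_eq_canonical :=
  EquivRel mp_ae_eq mp_ae_eq_refl mp_ae_eq_sym mp_ae_eq_trans.

Definition Aut : Type := {eq_quot mp_ae_eq}.
HB.instance Definition _ := Choice.on Aut.
HB.instance Definition _ := EqQuotient.on Aut.

Definition aut_to_fun (T : Aut) : X -> X := (repr T : mpb).
Coercion aut_to_fun : Aut >-> Funclass.

Definition aut_of (f : mpb) : Aut := \pi_Aut f.

Lemma aut_of_eqP (f g : mpb) : aut_of f = aut_of g <-> f = g %[ae mu].
Proof.
rewrite /aut_of; split.
  by move/eqmodP/asboolP.
by move=> fg; exact/eqmodP/asboolP.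
Qed.

Lemma aut_ofK (f : mpb) : aut_of f = f %[ae mu].
Proof. by apply/(aut_of_eqP (repr (aut_of f)))/reprK. Qed.

Lemma autP (S T : Aut) : S = T <-> S = T %[ae mu].
Proof.
split=> [->|]; first exact: aeW.
by move/aut_of_eqP; rewrite /aut_of !reprK.
Qed.

Lemma mp_ae (f : mpb) (P : X -> Prop) :
  (\forall x \ae mu, P x) -> \forall x \ae mu, P (f x).
Proof.
move=> [N [mN N0 PN]]; exists (f @^-1` N); split.
- by rewrite -[X in measurable X]setTI; exact: measurable_mp_fun.
- by rewrite mp_preserving.
- by move=> x /= nP; exact: PN.
Qed.

Lemma mp_inv_ae (f g : mpb) :
  f = g %[ae mu] -> mp_inv f = mp_inv g %[ae mu].
Proof.
move=> /(mp_ae (mp_invb f)); apply: filterS => x /= /(_ I) fg _.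
by rewrite -{2}(mp_invK f x) fg mp_funK.
Qed.

Definition aut_one : Aut := aut_of mp_id.
Definition aut_mul (S T : Aut) : Aut := aut_of (mp_comp (repr S) (repr T)).
Definition aut_inv (T : Aut) : Aut := aut_of (mp_invb (repr T)).

Lemma aut_mul_of (f g : mpb) :
  aut_mul (aut_of f) (aut_of g) = aut_of (mp_comp f g).
Proof.
apply/aut_of_eqP.
have := mp_ae g (aut_ofK f); apply: filterS2 (aut_ofK g) => x /= gE fE _.
by rewrite -[repr (aut_of g) x]/(aut_of g x) gE// -[LHS]/(aut_of f (g x)) fE.
Qed.

Lemma aut_inv_of (f : mpb) : aut_inv (aut_of f) = aut_of (mp_invb f).
Proof. exact/aut_of_eqP/mp_inv_ae/aut_ofK. Qed.

Let aut_mulA : associative aut_mul.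
Proof.
elim/quotW=> f; elim/quotW=> g; elim/quotW=> h.
rewrite -/(aut_of f) -/(aut_of g) -/(aut_of h) !aut_mul_of.
exact/aut_of_eqP/aeW.
Qed.

Let aut_mul1 : left_id aut_one aut_mul.
Proof.
by elim/quotW=> f; rewrite -/(aut_of f) aut_mul_of; apply/aut_of_eqP/aeW.
Qed.

Let aut_1mul : right_id aut_one aut_mul.
Proof.
by elim/quotW=> f; rewrite -/(aut_of f) aut_mul_of; apply/aut_of_eqP/aeW.
Qed.

Let aut_mulV : left_inverse aut_one aut_inv aut_mul.
Proof.
elim/quotW=> f; rewrite -/(aut_of f) aut_inv_of aut_mul_of.
by apply/aut_of_eqP/aeW => x _ /=; rewrite mp_funK.
Qed.

Let aut_Vmul : right_inverse aut_one aut_inv aut_mul.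
Proof.
elim/quotW=> f; rewrite -/(aut_of f) aut_inv_of aut_mul_of.
by apply/aut_of_eqP/aeW => x _ /=; rewrite mp_invK.
Qed.

HB.instance Definition _ :=
  isGroup.Build Aut aut_mulA aut_mul1 aut_1mul aut_mulV aut_Vmul.

Lemma aut_mulE (S T : Aut) : (S * T : Aut)%g = S \o T %[ae mu].
Proof. exact: aut_ofK. Qed.

Lemma aut_invE (T : Aut) : (T^-1 : Aut)%g = mp_inv (repr T) %[ae mu].
Proof. exact: aut_ofK. Qed.

Lemma aut_oneE : (1 : Aut)%g = id %[ae mu].
Proof. exact: aut_ofK. Qed.

End aut.

(* The values of [pfun] outside [dom] are irrelevant. *)
Record partial_iso (R : realType) (d : measure_display)
    (X : measurableType d) (mu : probability X R) := PartialIso {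
  dom : set X ;
  rng : set X ;
  pfun :> X -> X ;
  measurable_dom : measurable dom ;
  measurable_rng : measurable rng ;
  pfun_bij : set_bij dom rng pfun ;
  measurable_pfun : measurable_fun dom pfun ;
  measurable_pfun_image :
    forall A : set X, measurable A -> A `<=` dom -> measurable (pfun @` A) ;
  pfun_preserving :
    forall A : set X, measurable A -> A `<=` dom -> mu (pfun @` A) = mu A }.

Record graphing (R : realType) (d : measure_display)
    (X : measurableType d) (mu : probability X R) := Graphing {
  graphing_set : set (partial_iso mu) ;
  countable_graphing : countable graphing_set }.

Section graphing.
Context (R : realType) (d : measure_display) (X : measurableType d).
Variable mu : probability X R.
Implicit Types (Phi : graphing mu) (x y : X) (A B : set X).

Definition orbit_rel Phi : X -> X -> Prop :=
  clos_refl_sym_trans X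
    (fun x y => exists2 phi, graphing_set Phi phi & dom phi x /\ phi x = y).

Definition ergodic Phi : Prop :=
  forall A, measurable A ->
    (exists B, (forall x y, orbit_rel Phi x y -> B x -> B y) /\
      \forall x \ae mu, A x <-> B x) ->
    mu A = 0 \/ mu A = 1.

(* [y] is the image of [x] under some [phi] in [Phi], or under the inverse
   (from [rng phi] to [dom phi]) of some [phi] in [Phi]. *)
Definition graphing_step Phi x y : Prop :=
  exists2 phi, graphing_set Phi phi &
    (dom phi x /\ phi x = y) \/ (dom phi y /\ phi y = x).

Fixpoint graphing_path Phi (n : nat) x y : Prop :=
  if n is n'.+1
  then exists2 z, graphing_path Phi n' x z & graphing_step Phi z y
  else x = y.

(* The infimum is attained when [x] and [y] are in the same class, and is [+oo]
   otherwise. *)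
Definition graphing_dist Phi x y : \bar R :=
  ereal_inf [set n%:R%:E | n in [set n : nat | graphing_path Phi n x y]].

Definition full_group Phi : set (Aut mu) :=
  [set T | \forall x \ae mu, orbit_rel Phi x (T x)].

Definition L1_full_group Phi : set (Aut mu) :=
  [set T | full_group Phi T /\ \int[mu]_x graphing_dist Phi x (T x) < +oo].

End graphing.

(* Only the values of [psi] on [G] matter. *)
Definition group_isomorphism (gT hT : groupType) (G : set gT) (H : set hT)
    (psi : gT -> hT) : Prop :=
  set_bij G H psi /\
  forall S T, G S -> G T -> psi (S * T)%g = (psi S * psi T)%g.

(* Main.v *)
From HB Require Import structures.
Require Import Defs.
From mathcomp Require Import all_boot all_order all_algebra.
From mathcomp Require Import all_classical all_reals all_analysis.
From mathcomp Require Import measurable_realfun lra.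
From Stdlib Require Import Relation_Operators.

(** Write [G] and [H] for the two L1 full groups.  The proof recovers the measure
    algebra of [X] from the abstract group [G], in the spirit of Dye, Eigen and
    Fremlin, and then turns the resulting isomorphism of measure algebras into a
    point map.

    Two features of [G] are used throughout ([rich]): every nonnull set supports
    a nontrivial involution of [G], and an involution of [G] can be cut down to
    an invariant set without leaving [G].  Ergodicity gives the first: if [B] is
    a nonnull part of [C] of smaller measure, some word in the graphing carries
    a nonnull part of [C] minus [B] into [B], and swapping along this word moves
    points by a bounded distance.

    For an involution [p], the set of elements of [G] supported in the support
    of [p] is definable from the group law alone ([local_subgroupE]).  Hence an
    isomorphism [psi] preserves inclusions between supports of involutions.
    Since these supports generate the measure algebra, [psi] induces an
    isomorphism of measure algebras, handled as a relation [corresponds] between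
    representatives.  This relation is total ([corresponds_total]), respects
    complements, countable unions and almost everywhere inclusions, and is
    equivariant: if [B] corresponds to [A], the preimage of [B] under [psi T]
    corresponds to the preimage of [A] under [T] ([corresponds_preimage]).

    On a standard Borel space such an isomorphism comes from a point map
    ([point_realization]), and the maps obtained from [psi] and from its inverse
    are almost everywhere inverse to each other; [almost_bijection] corrects
    them on a null set.  Equivariance says that the point map conjugates [psi T]
    to [T].  What is left is that it preserves [mu]: the image [nu] of [mu] is
    invariant under [G] and has the null sets of [mu], and an ergodic graphing
    has only one such probability ([ergodic_invariant_measure]), because a word
    cannot carry a set on which [nu] exceeds [mu] into a set on which [mu]
    dominates [nu]. *)

Set Implicit Arguments.
Unset Strict Implicit.
Unset Printing Implicit Defensive.

Import Order.TTheory GRing.Theory Num.Theory.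

Local Open Scope classical_set_scope.
Local Open Scope ring_scope.
Local Open Scope ereal_scope.

(** * Almost everywhere reasoning about measure-preserving transformations *)

Lemma countable_enum (T : Type) (D : set T) (x0 : T) : countable D -> D x0 ->
  exists a : nat -> T, (forall n, D (a n)) /\ forall x, D x -> exists n, a n = x.
Proof.
move=> /countable_injP[g ginj] Dx0.
have /choice[a ha] : forall n, exists x, D x /\ forall y, D y -> g y = n -> x = y.
  move=> n; have [[y [Dy gy]]|h] := pselect (exists y, D y /\ g y = n).
    exists y; split=> // y' Dy' gy'; apply: ginj; rewrite ?inE//.
    by rewrite gy gy'.
  by exists x0; split=> // y Dy gy; exfalso; apply: h; exists y.
exists a; split=> [n|x Dx]; first by have [] := ha n.
by exists (g x); exact: (ha (g x)).2.
Qed.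

Notation "A `<=[ mu ] B" := (\forall x \ae mu, A x -> B x)
  (at level 70, B at next level, format "A  `<=[ mu ]  B").

Section almost_everywhere.
Context (R : realType) (d : measure_display) (X : measurableType d).
Context (mu : probability X R).
Implicit Types (A B C D : set X) (S T p f g : Aut mu).

Definition nonnull A : Prop := ~ \forall x \ae mu, ~ A x.

Lemma not_nonnull A : ~ nonnull A -> \forall x \ae mu, ~ A x.
Proof. exact: contrapT. Qed.

Lemma nonnullS A B : A `<=` B -> nonnull A -> nonnull B.
Proof. by move=> AB nA nB; apply: nA; apply: filterS nB => x nBx /AB. Qed.

Lemma nonnull_gt0 A : measurable A -> nonnull A -> 0 < mu A.
Proof.
move=> mA nA; rewrite lt0e measure_ge0 andbT; apply/eqP => A0; apply: nA.
by exists A; split=> // x /= /contrapT.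
Qed.

Lemma gt0_nonnull A : measurable A -> 0 < mu A -> nonnull A.
Proof.
move=> mA A0 nA; have : mu.-negligible A.
  by apply: negligibleS nA => x Ax /=; exact.
by move/(measure_negligible mA) => A00; move: A0; rewrite A00 ltxx.
Qed.

Lemma nonnull_exists (A : nat -> set X) :
  nonnull [set x | exists n, A n x] -> exists n, nonnull (A n).
Proof.
move=> nA; apply: contrapT => /forallNP h; apply: nA.
apply: filterS (_ : \forall x \ae mu, forall n, ~ A n x) => [x h' [n]|].
  exact: h'.
by apply: ae_foralln => n; exact: not_nonnull.
Qed.

Lemma nonnull_diff A B : ~ (A `<=[mu] B) -> nonnull (A `\` B).
Proof.
move=> nAB h; apply: nAB; apply: filterS h => x h Ax.
by apply: contrapT => nBx; exact: h.
Qed.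

Lemma nonnull_ae A (P : X -> Prop) : nonnull A -> (\forall x \ae mu, P x) ->
  nonnull (A `&` [set x | P x]).
Proof.
move=> nA hP h; apply: nA; apply: filterS2 hP h => x Px h Ax.
by apply: h.
Qed.

Lemma ae_forall_countable (I : countType) (P : I -> X -> Prop) :
  (forall i, \forall x \ae mu, P i x) -> \forall x \ae mu, forall i, P i x.
Proof.
move=> h.
have : \forall x \ae mu, forall n, if unpickle n is Some i then P i x else True.
  by apply: ae_foralln => n; case: unpickle => [i|]; [exact: h|exact: aeW].
by apply: filterS => x hx i; have := hx (pickle i); rewrite pickleK.
Qed.

Lemma measure_ae_le A B : measurable A -> measurable B ->
  A `<=[mu] B -> mu A <= mu B.
Proof.
move=> mA mB AB; have mD : measurable (A `\` B) by exact: measurableD.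
have D0 : mu (A `\` B) = 0.
  apply: measure_negligible => //; apply: negligibleS AB => x [Ax nBx] h.
  exact/nBx/h.
have : mu A <= mu ((A `\` B) `|` B).
  apply: le_measure; rewrite ?inE//; first exact: measurableU.
  by move=> x Ax; have [|] := pselect (B x); [right|left].
move/le_trans; apply; rewrite -[leRHS]add0e -D0.
by apply: measureU2.
Qed.

Lemma measure_ae_eq A B : measurable A -> measurable B ->
  (\forall x \ae mu, A x <-> B x) -> mu A = mu B.
Proof.
move=> mA mB AB; apply/eqP; rewrite eq_le.
by rewrite !measure_ae_le//; apply: filterS AB => x [].
Qed.

Lemma measurable_preimageT (f : X -> X) A :
  measurable_fun setT f -> measurable A -> measurable (f @^-1` A).
Proof. by move=> mf mA; rewrite -[X in measurable X]setTI; exact: mf. Qed.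

Lemma ae_mulE S T : \forall x \ae mu, (S * T : Aut mu)%g x = S (T x).
Proof. by apply: filterS (aut_mulE S T) => x /(_ I). Qed.

Lemma ae_oneE : \forall x \ae mu, (1%g : Aut mu) x = x.
Proof. by apply: filterS (aut_oneE mu) => x /(_ I). Qed.

Lemma ae_invK T : \forall x \ae mu, (T^-1 : Aut mu)%g (T x) = x.
Proof.
by apply: filterS2 (ae_mulE T^-1%g T) ae_oneE => x; rewrite mulVg => <- ->.
Qed.

Lemma ae_invKV T : \forall x \ae mu, T ((T^-1 : Aut mu)%g x) = x.
Proof.
by apply: filterS2 (ae_mulE T T^-1%g) ae_oneE => x; rewrite mulgV => <- ->.
Qed.

Lemma eq_aut S T : (\forall x \ae mu, S x = T x) -> S = T.
Proof. by move=> ST; apply/autP; apply: filterS ST. Qed.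

Lemma ae_aut T (P : X -> Prop) :
  (\forall x \ae mu, P x) -> \forall x \ae mu, P (T x).
Proof. exact: mp_ae. Qed.

Lemma aut_inj T : injective T.
Proof. exact: can_inj (mp_funK (repr T)). Qed.

Lemma measurable_aut T : measurable_fun setT T.
Proof. exact: measurable_mp_fun. Qed.

Lemma measurable_aut_preimage T A : measurable A -> measurable (T @^-1` A).
Proof. exact/measurable_preimageT/measurable_aut. Qed.

Lemma ae_invol p : (p * p = 1)%g -> \forall x \ae mu, p (p x) = x.
Proof.
by move=> pp; apply: filterS2 (ae_mulE p p) ae_oneE => x; rewrite pp => <- ->.
Qed.

Definition supp T : set X := [set x | T x <> x].

Lemma supp1 A : supp 1%g `<=[mu] A.
Proof. by apply: filterS ae_oneE => x. Qed.

Lemma supp_eq1 T : ~ nonnull (supp T) -> T = 1%g.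
Proof.
move=> /not_nonnull h; apply: eq_aut; by apply: filterS2 h ae_oneE => x /contrapT -> ->.
Qed.

Lemma aesub_trans A B C : A `<=[mu] B -> B `<=[mu] C -> A `<=[mu] C.
Proof. by apply: filterS2 => x AB BC /AB. Qed.

Lemma supp_stable T A : supp T `<=[mu] A -> \forall x \ae mu, A x -> A (T x).
Proof.
move=> TA; apply: filterS (ae_aut T TA) => x h Ax.
apply: contrapT => nA; apply: (nA); have /contrapT : ~ supp T (T x) by move/h.
by move/aut_inj ->.
Qed.

Lemma supp_inv T A : supp T `<=[mu] A -> supp T^-1%g `<=[mu] A.
Proof.
move=> TA; apply: filterS2 TA (ae_invK T) => x h e nT.
by apply: h => Tx; apply: nT; rewrite -{1}Tx e.
Qed.

Lemma supp_mul S T A : supp S `<=[mu] A -> supp T `<=[mu] A ->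
  supp (S * T)%g `<=[mu] A.
Proof.
move=> SA TA; apply: filterS3 SA TA (ae_mulE S T) => x hS hT STx; rewrite /supp/= STx => nST.
apply: contrapT => nA; apply: nST.
have /contrapT -> : ~ supp T x by move/hT.
by have /contrapT -> : ~ supp S x by move/hS.
Qed.

Lemma supp_conj T p A : supp p `<=[mu] A <->
  supp (T * p * T^-1)%g `<=[mu] [set x | A ((T^-1 : Aut mu)%g x)].
Proof.
split=> h.
- have h1 := ae_aut T^-1%g h; have h2 := ae_mulE (T * p)%g T^-1%g.
  have h3 := ae_aut T^-1%g (ae_mulE T p); have h4 := ae_invKV T.
  apply: filterS2 (filterI h1 h2) (filterI h3 h4) => x [g1 g2] [g3 g4].
  rewrite /supp/= g2 g3 => n; apply: g1 => e.
  by apply: n; rewrite e.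
- have h1 := ae_aut T h; have h2 := ae_aut T (ae_mulE (T * p)%g T^-1%g).
  have h3 := ae_mulE T p; have h4 := ae_invK T.
  apply: filterS2 (filterI h1 h2) (filterI h3 h4) => x [g1 g2] [g3 g4].
  move: g1; rewrite /supp/= g2 g4 g3 => g1 n; apply: g1 => /aut_inj e.
  by apply: n; rewrite e.
Qed.

Lemma disjoint_supp_commute S T A :
  supp S `<=[mu] A -> supp T `<=[mu] (~` A) -> (S * T = T * S)%g.
Proof.
move=> SA TA; apply: eq_aut.
near=> x.
have e1 : (S * T : Aut mu)%g x = S (T x) by near: x; exact: ae_mulE.
have e2 : (T * S : Aut mu)%g x = T (S x) by near: x; exact: ae_mulE.
have hS : S x <> x -> A x by near: x; exact: SA.
have hT : T x <> x -> ~ A x by near: x; exact: TA.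
have sS : A x -> A (S x) by near: x; exact: supp_stable.
have sT : ~ A x -> ~ A (T x) by near: x; exact: (supp_stable TA).
have hS' : S (T x) <> T x -> A (T x) by near: x; exact: (ae_aut T SA).
have hT' : T (S x) <> S x -> ~ A (S x) by near: x; exact: (ae_aut S TA).
rewrite e1 e2; have [Ax|nAx] := pselect (A x).
  have -> : T x = x by apply: contrapT => /hT.
  symmetry; apply: contrapT => n; apply: (hT' n); exact: sS.
have -> : S x = x by apply: contrapT => /hS.
by apply: contrapT => /hS'; exact: sT.
Unshelve. all: by end_near. Qed.

End almost_everywhere.

Section separation.
Context (R : realType) (d : measure_display) (X : measurableType d).
Context (mu : probability X R).
Implicit Types (A B C D : set X) (S T p f g : Aut mu).

Definition separating (E : nat -> set X) : Prop :=
  (forall n, measurable (E n)) /\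
  forall x y, x <> y -> exists n, E n x /\ ~ E n y.

Context (E : nat -> set X) (sepE : separating E).

Lemma measurable_neq (D : set X) (f g : X -> X) : measurable D ->
  measurable_fun D f -> measurable_fun D g ->
  measurable (D `&` [set x | f x <> g x]).
Proof.
move=> mD mf mg; have [mE E_sep] := sepE.
have -> : D `&` [set x | f x <> g x] =
    \bigcup_n ((D `&` f @^-1` E n) `\` (D `&` g @^-1` E n)).
  apply/seteqP; split=> x /=.
    by move=> [Dx /E_sep[n [fx gx]]]; exists n => //; split=> // -[].
  by move=> [n _ [[Dx fx] gx]]; split=> // fg; apply: gx; rewrite /= -fg.
apply: bigcupT_measurable => n; apply: measurableD; [exact: mf|exact: mg].
Qed.

Lemma measurable_supp T : measurable (supp T).
Proof.
rewrite /supp -[X in measurable X]setTI.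
by apply: measurable_neq => //; exact: measurable_aut.
Qed.

(** Some set of the family contains [f x] but not [g x] for a nonnull set of
    points [x]; keeping only these points pulls the two images apart. *)
Lemma separate_images C (f g : X -> X) : measurable C -> nonnull mu C ->
  measurable_fun setT f -> measurable_fun setT g ->
  (forall x, C x -> f x <> g x) ->
  exists D, [/\ measurable D, nonnull mu D, D `<=` C &
    forall x y, D x -> D y -> f x <> g y].
Proof.
move=> mC nC mf mg fg; have [mE E_sep] := sepE.
have [n nD] : exists n, nonnull mu
    (C `&` (f @^-1` E n) `\` (g @^-1` E n)).
  apply: nonnull_exists; apply: nonnullS nC => x Cx /=.
  by have [n [? ?]] := E_sep _ _ (fg _ Cx); exists n.
exists (C `&` (f @^-1` E n) `\` (g @^-1` E n)); split=> //.
- apply: measurableD; first apply: measurableI => //.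
    exact: measurable_preimageT mf (mE n).
  exact: measurable_preimageT mg (mE n).
- by move=> x [[]].
- by move=> x y [[_ fx] _] [_ gy] e; apply: gy; rewrite /= -e.
Qed.

End separation.

(** * Supports described in the language of groups *)

Section local_subgroup.
Context (gT : groupType).
Implicit Types (G : set gT) (p f g : gT).
Local Open Scope group_scope.

Definition is_subgroup G : Prop :=
  [/\ G 1, forall f g, G f -> G g -> G (f * g) & forall f, G f -> G f^-1].

Definition centralizer G (A : set gT) : set gT :=
  [set f | G f /\ forall g, A g -> f * g = g * f].

(** In the groups of transformations considered below, this set contains the
    restrictions of the involution [p] to invariant sets, and its elements all
    live on the support of [p]; it serves as a definable substitute for these
    restrictions. *)
Definition self_commuting G p : set gT :=
  [set f | [/\ centralizer G [set p] f, f * f = 1 &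
    forall g, centralizer G [set p] g ->
      f * (g * f * g^-1) = (g * f * g^-1) * f]].

(** The elements that live on the support of [p].  What centralizes all the
    restrictions of [p] may still agree with [p] on part of its support; taking
    squares removes this, and leaves elements living off the support of [p],
    numerous enough for their centralizer to live on it. *)
Definition local_subgroup G p : set gT :=
  centralizer G [set g * g | g in centralizer G (self_commuting G p)].

End local_subgroup.

Section transport.
Context (gT hT : groupType) (G : set gT) (H : set hT) (psi : gT -> hT).
Context (subG : is_subgroup G) (subH : is_subgroup H).
Context (psi_iso : group_isomorphism G H psi).
Local Open Scope group_scope.

Lemma iso_mem f : G f -> H (psi f).
Proof. by case: psi_iso => -[fH _ _] _; exact: fH. Qed.

Lemma iso_inj f g : G f -> G g -> psi f = psi g -> f = g.
Proof. by case: psi_iso => -[_ injf _] _ Gf Gg; apply: injf; rewrite inE. Qed.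

Lemma iso_surj h : H h -> exists2 f, G f & psi f = h.
Proof. by case: psi_iso => -[_ _ surjf] _ /surjf [f]; exists f. Qed.

Lemma isoM f g : G f -> G g -> psi (f * g) = psi f * psi g.
Proof. by case: psi_iso => _; exact. Qed.

Lemma iso1 : psi 1 = 1.
Proof.
have [G1 _ _] := subG.
by apply: (mulgI (psi 1)); rewrite -isoM// !mulg1.
Qed.

Lemma isoV f : G f -> psi f^-1 = (psi f)^-1.
Proof.
have [G1 _ GV] := subG => Gf.
by apply: (mulgI (psi f)); rewrite -isoM//; [rewrite !mulgV iso1|exact: GV].
Qed.

Lemma isoJ f g : G f -> G g -> psi (g * f * g^-1) = psi g * psi f * (psi g)^-1.
Proof.
have [_ GM GV] := subG => Gf Gg.
have GVg := GV _ Gg; have Ggf := GM _ _ Gg Gf.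
by rewrite (isoM Ggf GVg) (isoM Gg Gf) isoV.
Qed.

Lemma iso_commute f g : G f -> G g ->
  f * g = g * f <-> psi f * psi g = psi g * psi f.
Proof.
have [_ GM _] := subG => Gf Gg; rewrite -!isoM//; split=> [->//|].
by apply: iso_inj; exact: GM.
Qed.

Lemma iso_sqr1 f : G f -> f * f = 1 <-> psi f * psi f = 1.
Proof.
have [G1 GM _] := subG => Gf; rewrite -isoM// -iso1; split=> [->//|].
by apply: iso_inj => //; exact: GM.
Qed.

Lemma iso_centralizer (A : set gT) (B : set hT) f : A `<=` G -> B `<=` H ->
  (forall g, G g -> A g <-> B (psi g)) -> G f ->
  centralizer G A f <-> centralizer H B (psi f).
Proof.
move=> AG BH AB Gf; split=> -[_ h]; split=> //; first exact: iso_mem.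
  move=> b Bb; have [g Gg gb] := iso_surj (BH _ Bb); rewrite -gb.
  by apply/iso_commute => //; apply: h; apply/AB => //; rewrite gb.
move=> g Ag; have Gg := AG _ Ag; apply/iso_commute => //; apply: h.
exact/AB.
Qed.

Lemma iso_centralizer1 p f : G p -> G f ->
  centralizer G [set p] f <-> centralizer H [set psi p] (psi f).
Proof.
move=> Gp; apply: iso_centralizer => [_ ->//|_ ->|g Gg]; first exact: iso_mem.
by split=> [->//|/iso_inj ->].
Qed.

Lemma iso_self_commuting p f : G p -> G f ->
  self_commuting G p f <-> self_commuting H (psi p) (psi f).
Proof.
have [_ GM GV] := subG.
move=> Gp Gf; split=> -[c i h]; split.
- exact/iso_centralizer1.
- exact/iso_sqr1.
- move=> b cb; have [g Gg gb] : exists2 g, G g & psi g = b.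
    by apply: iso_surj; case: cb.
  have Gc : G (g * f * g^-1) by apply: (GM) => //; [exact: GM|exact: GV].
  have := h g; rewrite (iso_centralizer1 Gp Gg) gb => /(_ cb).
  by move/(iso_commute Gf Gc); rewrite isoJ// gb.
- exact/iso_centralizer1.
- exact/iso_sqr1.
- move=> g cg; have Gg : G g by case: cg.
  have Gc : G (g * f * g^-1) by apply: (GM) => //; [exact: GM|exact: GV].
  apply/(iso_commute Gf Gc); rewrite isoJ//.
  by apply: h; apply/iso_centralizer1.
Qed.

Lemma iso_local_subgroup p f : G p -> G f ->
  local_subgroup G p f <-> local_subgroup H (psi p) (psi f).
Proof.
have [_ GM GV] := subG; have [_ HM HV] := subH.
have selfcG q : self_commuting G q `<=` G by move=> g [[]].
have selfcH q : self_commuting H q `<=` H by move=> g [[]].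
move=> Gp Gf; apply: iso_centralizer => //.
- by move=> _ [g [Gg _] <-]; exact: GM.
- by move=> _ [g [Gg _] <-]; exact: HM.
move=> g Gg.
have cent_iff h : G h -> centralizer G (self_commuting G p) h <->
    centralizer H (self_commuting H (psi p)) (psi h).
  move=> Gh; apply: iso_centralizer => // k Gk.
  exact: iso_self_commuting.
split=> [[h ch <-]|[b cb bg]].
  have Gh : G h by case: ch.
  by exists (psi h); [exact/cent_iff|rewrite -isoM].
have [h Gh hb] : exists2 h, G h & psi h = b by apply: iso_surj; case: cb.
exists h; first by apply/cent_iff; rewrite ?hb.
by apply: iso_inj => //; [exact: GM|rewrite isoM// hb].
Qed.

End transport.

Section rich.
Context (R : realType) (d : measure_display) (X : measurableType d).
Context (mu : probability X R).
Implicit Types (A B C D : set X) (S T p f g : Aut mu) (G : set (Aut mu)).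

(** The only facts about a group of transformations that the reconstruction
    uses; in [rich_cut], [t] is the restriction of [p] to the invariant set
    formed by [D] and its image. *)
Record rich G : Prop := Rich {
  rich_subgroup : is_subgroup G ;
  rich_cut : forall p D, G p -> (p * p = 1)%g -> measurable D ->
    (forall x y, D x -> D y -> p x <> y) ->
    exists2 t, G t & \forall x \ae mu,
      (D x \/ D (p x) -> t x = p x) /\ (~ (D x \/ D (p x)) -> t x = x) ;
  rich_many : forall C, measurable C -> nonnull mu C ->
    exists p, [/\ G p, (p * p = 1)%g, supp p `<=[mu] C & p <> 1%g] }.

Context (E : nat -> set X) (sepE : separating E).
Context (G : set (Aut mu)) (richG : rich G).

Let G1 : G 1%g. Proof. by have [] := rich_subgroup richG. Qed.
Let GM f g : G f -> G g -> G (f * g)%g.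
Proof. by have [_ h _] := rich_subgroup richG; exact: h. Qed.
Let GV f : G f -> G (f^-1)%g.
Proof. by have [_ _ h] := rich_subgroup richG; exact: h. Qed.

(** If the involution [a] sends [D] off itself and the involution [b] lives on
    [D], then the square of [b a] agrees with [b] on [D]. *)
Lemma exists_noninvolution C : measurable C -> nonnull mu C ->
  exists h, [/\ G h, supp h `<=[mu] C & (h * h <> 1)%g].
Proof.
move=> mC nC; have [a [Ga aa aC a1]] := rich_many richG mC nC.
have nsa : nonnull mu (C `&` supp a).
  move=> h; apply: a1; apply: supp_eq1; apply; apply: filterS2 aC h => x aC h sa.
  by apply: h; split=> //; exact: aC.
have [D [mD nD DC aD]] : exists D, [/\ measurable D, nonnull mu D,
    D `<=` C `&` supp a & forall x y, D x -> D y -> a x <> y].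
  apply: (separate_images sepE (f := a) (g := id)) => //.
  - by apply: measurableI => //; exact: measurable_supp sepE _.
  - exact: measurable_aut.
  - by move=> x [].
have [b [Gb bb bD b1]] := rich_many richG mD nD.
exists (b * a)%g; split; first exact: GM.
  by apply: supp_mul => //; apply: filterS bD => x bD /bD /DC[].
move=> hh; apply: b1; apply: supp_eq1; apply.
near=> x; move=> sb.
have Dx : D x by move: sb; near: x; exact: bD.
have nDa : ~ D (a x) by move=> Dax; exact: aD Dx Dax erefl.
have ba : b (a x) = a x.
  by apply: contrapT => n; apply: nDa; move: n; near: x; exact: (ae_aut a bD).
have hE : (b * a : Aut mu)%g x = b (a x) by near: x; exact: ae_mulE.
have hhE : (b * a * (b * a) : Aut mu)%g x = (b * a : Aut mu)%g ((b * a : Aut mu)%g x).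
  by near: x; exact: ae_mulE.
have hE' : (b * a : Aut mu)%g (a x) = b (a (a x)) by near: x; exact: (ae_aut a (ae_mulE b a)).
have e1 : (1%g : Aut mu) x = x by near: x; exact: ae_oneE.
have ax : a (a x) = x by near: x; exact: ae_invol.
apply: sb; rewrite -[RHS]e1 -hh hhE hE ba hE' ax//.
Unshelve. all: by end_near. Qed.

Section involution.
Context (p : Aut mu) (Gp : G p) (pp : (p * p = 1)%g).

Local Notation C := (centralizer G [set p]).
Local Notation U := (self_commuting G p).
Local Notation V := (centralizer G U).

Let centE f : C f -> (f * p = p * f)%g.
Proof. by move=> [_]; exact. Qed.

(** Otherwise [f] moves some [D] outside the support of [p] off itself, and
    does not commute with its conjugate by a noninvolution living on [D]. *)
Lemma self_commuting_supp f : U f -> supp f `<=[mu] supp p.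
Proof.
move=> [[Gf _] ff hf]; apply: contrapT => /nonnull_diff nfp.
have mfp : measurable (supp f `\` supp p).
  by apply: measurableD; exact: measurable_supp sepE _.
have [D [mD nD Dfp fD]] : exists D, [/\ measurable D, nonnull mu D,
    D `<=` supp f `\` supp p & forall x y, D x -> D y -> f x <> y].
  apply: (separate_images sepE (f := f) (g := id)) => //.
  - exact: measurable_aut.
  - by move=> x [].
have [g [Gg gD gg]] := exists_noninvolution mD nD.
have Cg : C g.
  split=> // _ ->; apply: disjoint_supp_commute gD _.
  by apply: aeW => x sp /Dfp[].
have := hf g Cg => e; apply: gg; apply: eq_aut.
have gDV := supp_inv gD.
near=> x.
have e1 : (1%g : Aut mu) x = x by near: x; exact: ae_oneE.
have ggE : (g * g : Aut mu)%g x = g (g x) by near: x; exact: ae_mulE.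
rewrite e1 ggE; apply: contrapT => ggx.
have gx : g x <> x by move=> gx; apply: ggx; rewrite gx.
have Dx : D x by move: gx; near: x; exact: gD.
have sgD : D (g x) by move: (Dx); near: x; exact: supp_stable gD.
(* The two sides of [e] are evaluated at [g x], where they reduce to [x] and
   [g (g x)]. *)
have E1 : (f * (g * f * g^-1) : Aut mu)%g (g x) = f ((g * f * g^-1 : Aut mu)%g (g x)).
  by near: x; exact: (ae_aut g (ae_mulE f _)).
have E2 : (g * f * g^-1 : Aut mu)%g (g x) = (g * f : Aut mu)%g ((g^-1 : Aut mu)%g (g x)).
  by near: x; exact: (ae_aut g (ae_mulE _ _)).
have gK : (g^-1 : Aut mu)%g (g x) = x by near: x; exact: ae_invK.
have E3 : (g * f : Aut mu)%g x = g (f x) by near: x; exact: ae_mulE.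
have nDf : ~ D (f x) by move=> /(fD _ _ Dx).
have gf : g (f x) = f x.
  by apply: contrapT => n; apply: nDf; move: n; near: x; exact: (ae_aut f gD).
have ffx : f (f x) = x by near: x; exact: ae_invol.
have F1 : (g * f * g^-1 * f : Aut mu)%g (g x) = (g * f * g^-1 : Aut mu)%g (f (g x)).
  by near: x; exact: (ae_aut g (ae_mulE _ _)).
have F2 : (g * f * g^-1 : Aut mu)%g (f (g x)) = (g * f : Aut mu)%g ((g^-1 : Aut mu)%g (f (g x))).
  by near: x; exact: (ae_aut g (ae_aut f (ae_mulE _ _))).
have nDfy : ~ D (f (g x)) by move=> /(fD _ _ sgD).
have gfy : (g^-1 : Aut mu)%g (f (g x)) = f (g x).
  by apply: contrapT => n; apply: nDfy; move: n; near: x; exact: (ae_aut g (ae_aut f gDV)).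
have F3 : (g * f : Aut mu)%g (f (g x)) = g (f (f (g x))).
  by near: x; exact: (ae_aut g (ae_aut f (ae_mulE _ _))).
have ffy : f (f (g x)) = (g x) by near: x; exact: (ae_aut g (ae_invol ff)).
apply: ggx; apply/esym; rewrite -[in RHS]ffy -F3 -gfy -F2 -F1 -e E1 E2 gK E3 gf ffx//.
Unshelve. all: by end_near. Qed.

Lemma two_valued_commute (s t : Aut mu) : (s * p = p * s)%g -> (t * p = p * t)%g ->
  (\forall x \ae mu, s x = x \/ s x = p x) ->
  (\forall x \ae mu, t x = x \/ t x = p x) -> (s * t = t * s)%g.
Proof.
move=> sp tp s2 t2; apply: eq_aut; near=> x.
have stE : (s * t : Aut mu)%g x = s (t x) by near: x; exact: ae_mulE.
have tsE : (t * s : Aut mu)%g x = t (s x) by near: x; exact: ae_mulE.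
have spE : s (p x) = p (s x).
  have <- : (s * p : Aut mu)%g x = s (p x) by near: x; exact: ae_mulE.
  by rewrite sp; near: x; exact: ae_mulE.
have tpE : t (p x) = p (t x).
  have <- : (t * p : Aut mu)%g x = t (p x) by near: x; exact: ae_mulE.
  by rewrite tp; near: x; exact: ae_mulE.
have sx : s x = x \/ s x = p x by near: x.
have tx : t x = x \/ t x = p x by near: x.
rewrite stE tsE; case: sx => sx; case: tx => tx.
- by rewrite tx sx tx.
- by rewrite tx spE sx tx.
- by rewrite tx sx tpE tx.
- by rewrite tx sx spE tpE sx tx.
Unshelve. all: by end_near. Qed.

(** A restriction [t] of [p] has [t x] equal to [x] or [p x], and so do its
    conjugates under the centralizer of [p]; such maps commute. *)
Lemma cut_self_commuting D (t : Aut mu) : G t -> (\forall x \ae mu,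
    (D x \/ D (p x) -> t x = p x) /\ (~ (D x \/ D (p x)) -> t x = x)) ->
  U t.
Proof.
move=> Gt tE.
have ppE := ae_invol pp.
have t2 : \forall x \ae mu, t x = x \/ t x = p x.
  apply: filterS tE => x [h1 h2].
  by have [/h1|/h2] := pselect (D x \/ D (p x)); [right|left].
have tp : (t * p = p * t)%g.
  apply: eq_aut; near=> x.
  have tpE : (t * p : Aut mu)%g x = t (p x) by near: x; exact: ae_mulE.
  have ptE : (p * t : Aut mu)%g x = p (t x) by near: x; exact: ae_mulE.
  have ppx : p (p x) = x by near: x.
  have [h1 h2] : (D x \/ D (p x) -> t x = p x) /\
    (~ (D x \/ D (p x)) -> t x = x) by near: x.
  have [h3 h4] : (D (p x) \/ D (p (p x)) -> t (p x) = p (p x)) /\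
    (~ (D (p x) \/ D (p (p x))) -> t (p x) = p x) by near: x; exact: ae_aut tE.
  rewrite ppx in h3 h4; rewrite tpE ptE.
  have [DD|nDD] := pselect (D x \/ D (p x)).
    by rewrite h1// h3 ?ppx//; case: DD; [right|left].
  by rewrite h2// h4// => -[]; [move=> ?; apply: nDD; right|move=> ?; apply: nDD; left].
have Ct : C t by split=> // _ ->.
split=> //.
  apply: eq_aut; near=> x.
  have -> : (t * t : Aut mu)%g x = t (t x) by near: x; exact: ae_mulE.
  have -> : (1%g : Aut mu) x = x by near: x; exact: ae_oneE.
  have tpE : t (p x) = p (t x).
    have <- : (t * p : Aut mu)%g x = t (p x) by near: x; exact: ae_mulE.
    by rewrite tp; near: x; exact: ae_mulE.
  have ppx : p (p x) = x by near: x.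
  have [tx|tx] : t x = x \/ t x = p x by near: x.
    by rewrite tx.
  by rewrite tx tpE tx.
suff conjC (g : Aut mu) : C g -> (t * (g * t * g^-1) = g * t * g^-1 * t)%g.
  by move=> g; exact: conjC.
move=> Cg; have gp := centE Cg.
have gVp : (g^-1 * p = p * g^-1)%g.
  by apply: (mulgI g); rewrite mulgA mulgV mul1g mulgA gp mulgK.
apply: two_valued_commute => //.
  by rewrite -[LHS]mulgA gVp mulgA -[(g * t * p)%g]mulgA tp mulgA gp -!mulgA.
near=> x.
have e1 : (g * t * g^-1 : Aut mu)%g x = (g * t : Aut mu)%g ((g^-1 : Aut mu)%g x).
  by near: x; exact: ae_mulE.
have e2 : (g * t : Aut mu)%g ((g^-1 : Aut mu)%g x) = g (t ((g^-1 : Aut mu)%g x)).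
  by near: x; exact: (ae_aut g^-1%g (ae_mulE g t)).
have gK : g ((g^-1 : Aut mu)%g x) = x by near: x; exact: ae_invKV.
have gpE : g (p ((g^-1 : Aut mu)%g x)) = p (g ((g^-1 : Aut mu)%g x)).
  have <- : (g * p : Aut mu)%g ((g^-1 : Aut mu)%g x) = g (p ((g^-1 : Aut mu)%g x)).
    by near: x; exact: (ae_aut g^-1%g (ae_mulE g p)).
  by rewrite gp; near: x; exact: (ae_aut g^-1%g (ae_mulE p g)).
rewrite e1 e2.
have [->|->] : t ((g^-1 : Aut mu)%g x) = (g^-1 : Aut mu)%g x \/
    t ((g^-1 : Aut mu)%g x) = p ((g^-1 : Aut mu)%g x).
  by near: x; exact: (ae_aut g^-1%g t2).
- by left.
- by right; rewrite gpE gK.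
Unshelve. all: by end_near. Qed.

Lemma self_commuting_id : U p.
Proof.
apply: (@cut_self_commuting setT) => //; apply: aeW => x; split=> // nT.
by exfalso; apply: nT; left.
Qed.

(** An element of [V] commutes with all restrictions of [p], so it sends [x] to
    [x] or [p x] on the support of [p]; and it commutes with [p]. *)
Lemma sqr_centralizer_supp f : V f -> supp (f * f)%g `<=[mu] ~` supp p.
Proof.
move=> Vf; have Gf : G f by case: Vf.
pose C0 := supp p `&` supp f `&` [set x | f x <> p x].
have nC0 : ~ nonnull mu C0.
  move=> nC0.
  have mC0 : measurable C0.
    apply: (measurable_neq sepE).
    - by apply: measurableI; exact: measurable_supp sepE _.
    - by apply: measurable_funTS; exact: measurable_aut.
    - by apply: measurable_funTS; exact: measurable_aut.
  have mid : measurable_fun setT (@idfun X) by exact: measurable_id.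
  (* [D] is to be disjoint from [p D] and [f D], and these from each other. *)
  have [D1 [mD1 nD1 D10 pD1]] := separate_images sepE mC0 nC0
    (measurable_aut p) mid (fun x h => h.1.1).
  have [D2 [mD2 nD2 D21 fD2]] := separate_images sepE mD1 nD1
    (measurable_aut f) mid (fun x h => (D10 _ h).1.2).
  have [D [mD nD D2D fpD]] := separate_images sepE mD2 nD2
    (measurable_aut f) (measurable_aut p) (fun x h => (D10 _ (D21 _ h)).2).
  have pD x y : D x -> D y -> p x <> y.
    by move=> Dx Dy; apply: pD1; apply: D21; exact: D2D.
  have fD x y : D x -> D y -> f x <> y.
    by move=> Dx Dy; apply: fD2; exact: D2D.
  have [t Gt tE] := rich_cut richG Gp pp mD pD.
  have Ut := cut_self_commuting Gt tE.
  have ft : (f * t = t * f)%g by case: Vf => _; exact.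
  apply: nD; near=> x => Dx.
  have ftE : (f * t : Aut mu)%g x = f (t x) by near: x; exact: ae_mulE.
  have tfE : (t * f : Aut mu)%g x = t (f x) by near: x; exact: ae_mulE.
  have [h1 _] : (D x \/ D (p x) -> t x = p x) /\
    (~ (D x \/ D (p x)) -> t x = x) by near: x.
  have [_ h2] : (D (f x) \/ D (p (f x)) -> t (f x) = p (f x)) /\
    (~ (D (f x) \/ D (p (f x))) -> t (f x) = f x) by near: x; exact: ae_aut tE.
  have ppfx : p (p (f x)) = f x by near: x; exact: (ae_aut f (ae_invol pp)).
  have tx : t x = p x by apply: h1; left.
  have tfx : t (f x) = f x.
    apply: h2 => -[Dfx|Dpfx]; first exact: fD Dx Dfx erefl.
    by apply: fpD Dx Dpfx _; rewrite ppfx.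
  have : f (p x) = f x by rewrite -tx -ftE ft tfE.
  by move/aut_inj; exact: (D10 _ (D21 _ (D2D _ Dx))).1.1.
have fp : (f * p = p * f)%g by case: Vf => _; apply; exact: self_commuting_id.
have fC0 := not_nonnull nC0.
near=> x => + px; apply.
have -> : (f * f : Aut mu)%g x = f (f x) by near: x; exact: ae_mulE.
have fpE : f (p x) = p (f x).
  have <- : (f * p : Aut mu)%g x = f (p x) by near: x; exact: ae_mulE.
  by rewrite fp; near: x; exact: ae_mulE.
have ppx : p (p x) = x by near: x; exact: ae_invol.
have nC0x : ~ C0 x by near: x.
have [fx|fx] := pselect (f x = x); first by rewrite !fx.
have fpx : f x = p x by apply: contrapT => fpx; exact: nC0x.
by rewrite [in f (f x)]fpx fpE fpx.
Unshelve. all: by end_near. Qed.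

Theorem local_subgroupE f :
  local_subgroup G p f <-> G f /\ supp f `<=[mu] supp p.
Proof.
split=> [[Gf Wf]|[Gf fp]]; last first.
  split=> // _ [g Vg <-]; apply: disjoint_supp_commute fp _.
  exact: sqr_centralizer_supp.
split=> //; apply: contrapT => /nonnull_diff nfp.
have mfp : measurable (supp f `\` supp p).
  by apply: measurableD; exact: measurable_supp sepE _.
have [D [mD nD Dfp fD]] : exists D, [/\ measurable D, nonnull mu D,
    D `<=` supp f `\` supp p & forall x y, D x -> D y -> f x <> y].
  apply: (separate_images sepE (f := f) (g := id)) => //.
  - exact: measurable_aut.
  - by move=> x [].
have [g [Gg gD gg]] := exists_noninvolution mD nD.
have Vg : V g.
  split=> // h Uh; apply: disjoint_supp_commute gD _.
  by apply: filterS (self_commuting_supp Uh) => x hx /hx px /Dfp[].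
have fg := Wf _ (ex_intro2 _ _ g Vg erefl).
have ggD : supp (g * g)%g `<=[mu] D by exact: supp_mul.
apply: gg; apply: eq_aut; near=> x.
have -> : (1%g : Aut mu) x = x by near: x; exact: ae_oneE.
apply: contrapT => ggx.
have Dx : D x by move: ggx; near: x.
have fgE : (f * (g * g) : Aut mu)%g x = f ((g * g : Aut mu)%g x).
  by near: x; exact: ae_mulE.
have gfE : (g * g * f : Aut mu)%g x = (g * g : Aut mu)%g (f x).
  by near: x; exact: ae_mulE.
have nDf : ~ D (f x) by move=> /(fD _ _ Dx).
have ggf : (g * g : Aut mu)%g (f x) = f x.
  by apply: contrapT => n; apply: nDf; move: n; near: x; exact: (ae_aut f ggD).
by apply: ggx; apply: (@aut_inj _ _ _ _ f); rewrite -fgE fg gfE.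
Unshelve. all: by end_near. Qed.

End involution.
End rich.

(** * The induced map of measure algebras *)

Section exhaustion.
Context (R : realType) (d : measure_display) (X : measurableType d).
Context (mu : probability X R).
Implicit Types (A B C D : set X) (F : set (set X)).

(** A countable union of members of [F] of maximal measure cannot
    miss a nonnull part of [A]. *)
Lemma exhaustion F A : measurable A -> F set0 ->
  (forall D, F D -> measurable D) ->
  (forall C, measurable C -> C `<=` A -> nonnull mu C ->
    exists D, [/\ F D, D `<=[mu] C & nonnull mu D]) ->
  exists u : nat -> set X, (forall n, F (u n)) /\ A `<=[mu] \bigcup_n u n.
Proof.
move=> mA F0 mF many.
pose S := [set mu (\bigcup_n u n) | u in [set u : nat -> set X | forall n, F (u n)]].
have mU (u : nat -> set X) : (forall n, F (u n)) -> measurable (\bigcup_n u n).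
  by move=> Fu; apply: bigcupT_measurable => n; exact: mF.
have S1 : ubound S 1.
  by move=> _ [u Fu <-]; exact: probability_le1 (mU _ Fu).
have S0 : S 0 by exists (fun=> set0) => //=; rewrite bigcup0// measure0.
have supS : ereal_sup S \is a fin_num.
  rewrite fin_real//; apply/andP; split.
    by rewrite (lt_le_trans _ (ereal_sup_ubound S0)).
  by rewrite (le_lt_trans (ge_ereal_sup S1))// ltry.
have near_sup k : exists u : nat -> set X, (forall n, F (u n)) /\
    ereal_sup S - (k.+1%:R^-1)%:E < mu (\bigcup_n u n).
  have [|_ [u Fu <-] hu] := @ub_ereal_sup_adherent _ S k.+1%:R^-1 _ supS => //.
  by exists u.
have /choice[u hu] := near_sup.
pose v n := if unpickle n is Some (i, j) then u i j else set0.
have Fv n : F (v n).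
  by rewrite /v; case: unpickle => // -[i j]; have [h _] := hu i; exact: h.
pose U := \bigcup_n v n.
have uU k : \bigcup_n u k n `<=` U.
  move=> x [n _ ux]; exists (pickle (k, n)) => //.
  by rewrite /v pickleK.
have supU : ereal_sup S <= mu U.
  apply/lee_addgt0Pr => e e0.
  have [k ke] : exists k : nat, (k.+1%:R^-1 < e)%R.
    have [k _ /(_ _ (leqnn k)) h] := near_infty_natSinv_lt (PosNum e0).
    by exists k.
  rewrite -leeBlDr//; apply: le_trans (le_measure _ _ _ (uU k)); last first.
  - by rewrite inE; exact: mU.
  - by rewrite inE; apply: mU; have [] := hu k.
  apply: le_trans (ltW (hu k).2).
  by rewrite leeB// lee_fin ltW.
exists v; split=> //; apply: contrapT => /nonnull_diff nAU.
have mAU : measurable (A `\` U) by apply: measurableD => //; exact: mU.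
have [|D [FD DAU nD]] := many _ mAU _ nAU; first by move=> x [].
pose w n := if n is n'.+1 then v n' else D.
have Fw n : F (w n) by case: n.
have wE : \bigcup_n w n = U `|` D.
  apply/seteqP; split=> x.
    by move=> [[|n] _ /= wx]; [right|left; exists n].
  by move=> [[n _ vx]|Dx]; [exists n.+1|exists 0%N].
have nDU : nonnull mu (D `\` U).
  move=> h; apply: nD; apply: filterS2 DAU h => x h1 h2 Dx.
  by apply: h2; split=> //; have [] := h1 Dx.
have mDU : measurable (D `\` U) by apply: measurableD; [exact: mF|exact: mU].
have : mu (U `|` D) <= mu U.
  by apply: le_trans supU; apply: ereal_sup_ubound; exists w => //; rewrite wE.
have -> : U `|` D = U `|` (D `\` U) by rewrite setUDr setDv setD0.
rewrite measureU//; [|exact: mU|by rewrite setDE setIA setIAC setICr set0I].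
by rewrite -leeBrDl ?fin_num_measure ?subee ?fin_num_measure//;
  [rewrite leNgt nonnull_gt0| exact: mU|exact:mU].
Qed.

End exhaustion.

Section correspondence.
Context (R : realType) (d : measure_display) (X : measurableType d).
Context (mu : probability X R).
Implicit Types (A B C D : set X) (S T p q f g r s : Aut mu) (G : set (Aut mu)).
Context (E : nat -> set X) (sepE : separating E).

(** [B] is the image of [A] under the map of measure algebras induced by
    [psi], as seen by the supports of involutions. *)
Definition corresponds G (psi : Aut mu -> Aut mu) A B : Prop :=
  forall p, G p -> (p * p = 1)%g ->
    (supp p `<=[mu] A -> supp (psi p) `<=[mu] B) /\
    (supp p `<=[mu] ~` A -> supp (psi p) `<=[mu] ~` B).

Context (G H : set (Aut mu)) (richG : rich G) (richH : rich H).
Context (psi : Aut mu -> Aut mu) (psi_iso : group_isomorphism G H psi).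

Let sG := rich_subgroup richG.
Let sH := rich_subgroup richH.

Lemma supp_iso p f : G p -> (p * p = 1)%g -> G f ->
  supp f `<=[mu] supp p <-> supp (psi f) `<=[mu] supp (psi p).
Proof.
move=> Gp pp Gf; have Hp := iso_mem psi_iso Gp; have Hf := iso_mem psi_iso Gf.
have := local_subgroupE sepE richG Gp pp f.
have /(local_subgroupE sepE richH Hp) : (psi p * psi p = 1)%g.
  exact/(iso_sqr1 sG psi_iso Gp).
have := iso_local_subgroup sG sH psi_iso Gp Gf.
by move=> h1 /(_ (psi f)) h2 h3; tauto.
Qed.

Let psi1 f : G f -> psi f = 1%g -> f = 1%g.
Proof.
have [G1 _ _] := sG; move=> Gf f1.
by apply: (iso_inj psi_iso Gf G1); rewrite f1 (iso1 sG psi_iso).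
Qed.

Let supp_absurd s B : G s -> s <> 1%g -> supp (psi s) `<=[mu] B ->
  supp (psi s) `<=[mu] ~` B -> False.
Proof.
move=> Gs s1 sB sB'; apply: s1; apply: psi1 => //; apply: supp_eq1; apply.
by apply: filterS2 sB sB' => x h1 h2 sx; exact: h2 sx (h1 sx).
Qed.

Lemma pull_involution C : measurable C -> nonnull mu C ->
  exists r, [/\ G r, (r * r = 1)%g, supp (psi r) `<=[mu] C & r <> 1%g].
Proof.
move=> mC nC; have [q [Hq qq qC q1]] := rich_many richH mC nC.
have [r Gr rq] := iso_surj psi_iso Hq.
exists r; split=> //; last 2 first.
- by rewrite rq.
- by move=> r1; apply: q1; rewrite -rq r1 (iso1 sG psi_iso).
- by apply/(iso_sqr1 sG psi_iso Gr); rewrite rq.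
Qed.

Lemma refine_involution r A : G r -> (r * r = 1)%g -> measurable A ->
  ~ (supp r `<=[mu] ~` A) ->
  exists s, [/\ G s, (s * s = 1)%g, s <> 1%g, supp s `<=[mu] A &
    supp (psi s) `<=[mu] supp (psi r)].
Proof.
move=> Gr rr mA nrA.
have n : nonnull mu (supp r `&` A).
  move=> h; apply: nrA; apply: filterS h => x h sx Ax; exact: h.
have m : measurable (supp r `&` A).
  by apply: measurableI => //; exact: measurable_supp sepE _.
have [s [Gs ss sC s1]] := rich_many richG m n.
exists s; split=> //; first by apply: filterS sC => x h /h[].
by apply/(supp_iso Gr rr Gs); apply: filterS sC => x h /h[].
Qed.

(** A nonnull part of [B] outside [B'] would contain the support of some [psi r].
    If [r] lives off [A], then [psi r] lives off [B]; otherwise a part of [r]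
    lives in [A], hence in [A'], and its image lives in [B'].  The same dichotomy
    proves [corresponds_bigcup] and [corresponds_reflect]. *)
Lemma corresponds_le A A' B B' : measurable A -> measurable B ->
  measurable B' -> corresponds G psi A B -> corresponds G psi A' B' ->
  A `<=[mu] A' -> B `<=[mu] B'.
Proof.
move=> mA mB mB' AB AB' AA'; apply: contrapT => /nonnull_diff nBB'.
have [r [Gr rr rBB' r1]] := pull_involution (measurableD mB mB') nBB'.
have rB : supp (psi r) `<=[mu] B by apply: filterS rBB' => x h /h[].
have rB' : supp (psi r) `<=[mu] ~` B' by apply: filterS rBB' => x h /h[].
have [/(AB _ Gr rr).2|nrA] := pselect (supp r `<=[mu] ~` A).
  exact: supp_absurd.
have [s [Gs ss s1 sA sr]] := refine_involution Gr rr mA nrA.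
apply: (@supp_absurd s B') => //; last exact: aesub_trans sr rB'.
by apply: (AB' s Gs ss).1; exact: aesub_trans sA AA'.
Qed.

Lemma correspondsC A B : corresponds G psi A B -> corresponds G psi (~` A) (~` B).
Proof. by move=> AB p Gp pp; have [h1 h2] := AB p Gp pp; rewrite !setCK. Qed.

Lemma corresponds_bigcup (A B : nat -> set X) :
  (forall n, measurable (A n)) -> (forall n, measurable (B n)) ->
  (forall n, corresponds G psi (A n) (B n)) ->
  corresponds G psi (\bigcup_n A n) (\bigcup_n B n).
Proof.
move=> mA mB AB p Gp pp; split=> hp; last first.
  have h n : supp (psi p) `<=[mu] ~` B n.
    apply: (AB n p Gp pp).2; apply: filterS hp => x h /h nA Ax.
    by apply: nA; exists n.
  apply: filterS (ae_foralln h) => x hx sx [n _]; exact: hx.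
apply: contrapT => /nonnull_diff npB.
have mpB : measurable (supp (psi p) `\` \bigcup_n B n).
  by apply: measurableD; [exact: measurable_supp sepE _|exact: bigcupT_measurable].
have [r [Gr rr rC r1]] := pull_involution mpB npB.
have rp : supp r `<=[mu] supp p.
  by apply/(supp_iso Gp pp Gr); apply: filterS rC => x h /h[].
have [n nrA] : exists n, ~ (supp r `<=[mu] ~` A n).
  apply/existsNP => h; apply: r1; apply: supp_eq1; apply.
  apply: filterS3 (ae_foralln h) rp hp => x h1 h2 h3 sx.
  by have [n _ Ax] := h3 (h2 sx); exact: h1 n sx Ax.
have [s [Gs ss s1 sA sr]] := refine_involution Gr rr (mA n) nrA.
apply: (@supp_absurd s (B n)) => //; first exact: (AB n s Gs ss).1.
apply: filterS2 sr rC => x h1 h2 /h1/h2[_ nB] Bx.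
by apply: nB; exists n.
Qed.

Lemma corresponds_supp p : G p -> (p * p = 1)%g ->
  corresponds G psi (supp p) (supp (psi p)).
Proof.
move=> Gp pp q Gq qq; split=> [|hqp]; first by move/(supp_iso Gp pp Gq).
apply: contrapT => npq.
have nC : nonnull mu (supp (psi q) `&` supp (psi p)).
  by move=> h; apply: npq; apply: filterS h => x h sq sp; exact: h.
have mC : measurable (supp (psi q) `&` supp (psi p)).
  by apply: measurableI; exact: measurable_supp sepE _.
have [r [Gr rr rC r1]] := pull_involution mC nC.
have rp : supp r `<=[mu] supp p.
  by apply/(supp_iso Gp pp Gr); apply: filterS rC => x h /h[].
have rq : supp r `<=[mu] supp q.
  by apply/(supp_iso Gq qq Gr); apply: filterS rC => x h /h[].
apply: r1; apply: supp_eq1; apply.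
by apply: filterS3 rp rq hqp => x h1 h2 h3 sx; exact: h3 (h2 sx) (h1 sx).
Qed.

Lemma corresponds_ae A A' B : A `<=[mu] A' -> A' `<=[mu] A ->
  corresponds G psi A B -> corresponds G psi A' B.
Proof.
move=> AA' A'A AB p Gp pp; have [h1 h2] := AB p Gp pp; split=> h.
  by apply: h1; exact: aesub_trans h A'A.
by apply: h2; apply: filterS2 h AA' => x h AA' /h nA /AA'.
Qed.

(** Supports of involutions of [G] correspond to supports of involutions of [H],
    and countably many of them exhaust [A]. *)
Lemma corresponds_total A : measurable A ->
  exists2 B, measurable B & corresponds G psi A B.
Proof.
move=> mA; have [G1 _ _] := sG.
have [|||u [Fu Au]] := @exhaustion _ _ _ mu [set D | exists p,
    [/\ G p, (p * p = 1)%g, supp p `<=[mu] A & measurable D /\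
      (D `<=[mu] supp p /\ supp p `<=[mu] D)]] A mA.
- exists 1%g; rewrite mulg1; split=> //; first exact: supp1.
  by split=> //; split; [exact: aeW|exact: supp1].
- by move=> D [p [_ _ _ []]].
- move=> C mC CA nC; have [p [Gp pp pC p1]] := rich_many richG mC nC.
  exists (supp p); split=> //; last by move=> h; apply: p1; exact: supp_eq1.
  exists p; split=> //; first by apply: filterS pC => x h /h /CA.
  by split; [exact: measurable_supp sepE _|split; exact: aeW].
have /choice[p hp] := Fu.
have AE : \bigcup_n supp (p n) `<=[mu] A /\ A `<=[mu] \bigcup_n supp (p n).
  split.
    have h n : supp (p n) `<=[mu] A by have [] := hp n.
    by apply: filterS (ae_foralln h) => x hx [n _]; exact: hx.
  have h n : u n `<=[mu] supp (p n) by have [_ _ _ [_ []]] := hp n.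
  apply: filterS2 (ae_foralln h) Au => x hx ux /ux[n _ unx].
  by exists n => //; exact: hx.
exists (\bigcup_n supp (psi (p n))).
  by apply: bigcupT_measurable => n; exact: measurable_supp sepE _.
apply: (corresponds_ae AE.1 AE.2); apply: corresponds_bigcup => n.
- exact: measurable_supp sepE _.
- exact: measurable_supp sepE _.
- by have [Gp pp _ _] := hp n; exact: corresponds_supp.
Qed.

Lemma corresponds_reflect A B r : measurable A -> measurable B ->
  corresponds G psi A B ->
  G r -> (r * r = 1)%g -> supp (psi r) `<=[mu] B -> supp r `<=[mu] A.
Proof.
move=> mA mB AB Gr rr rB; apply: contrapT => nrA.
have nrA' : ~ (supp r `<=[mu] ~` ~` A) by rewrite setCK.
have [s [Gs ss s1 sA sr]] := refine_involution Gr rr (measurableC mA) nrA'.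
apply: (@supp_absurd s B) => //; first exact: aesub_trans sr rB.
exact: (AB s Gs ss).2.
Qed.

Lemma supp_preimage T p A : supp p `<=[mu] T @^-1` A <->
  supp (T * p * T^-1)%g `<=[mu] A.
Proof.
split=> [/(supp_conj T) h|h].
  by apply: filterS2 h (ae_invKV T) => x h e /h /=; rewrite e.
by apply/(supp_conj T); apply: filterS2 h (ae_invKV T) => x h e /h /=; rewrite e.
Qed.

(** An involution [p] lives in the preimage of [A] under [T] exactly when its
    conjugate by [T] lives in [A], and [psi] respects conjugation. *)
Lemma corresponds_preimage A B T : G T -> corresponds G psi A B ->
  corresponds G psi (T @^-1` A) (psi T @^-1` B).
Proof.
have [G1 GM GV] := sG.
move=> GT AB p Gp pp.
have Gc : G (T * p * T^-1)%g by apply: (GM); [exact: GM|exact: GV].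
have cc : (T * p * T^-1 * (T * p * T^-1) = 1)%g.
  by rewrite !mulgA mulgVK -(mulgA T) pp mulg1 mulgV.
have [h1 h2] := AB _ Gc cc; rewrite (isoJ sG psi_iso Gp GT) in h1 h2.
split=> h.
  by apply/(supp_preimage (psi T) (psi p) B)/h1/(supp_preimage T p A).
by apply/(supp_preimage (psi T) (psi p) (~` B))/h2/(supp_preimage T p (~` A)).
Qed.

End correspondence.

Section inverse.
Context (R : realType) (d : measure_display) (X : measurableType d).
Context (mu : probability X R).
Implicit Types (A B C D : set X) (S T p q f g r s : Aut mu) (G : set (Aut mu)).
Context (E : nat -> set X) (sepE : separating E).
Context (G H : set (Aut mu)) (richG : rich G) (richH : rich H).
Context (psi : Aut mu -> Aut mu) (psi_iso : group_isomorphism G H psi).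

Lemma inverse_iso : exists2 phi : Aut mu -> Aut mu,
  group_isomorphism H G phi & (forall f, G f -> phi (psi f) = f).
Proof.
have [_ GM _] := rich_subgroup richG.
have /choice[phi hphi] : forall h, exists f, H h -> G f /\ psi f = h.
  move=> h; have [Hh|nHh] := pselect (H h); last by exists h.
  by have [f Gf fh] := iso_surj psi_iso Hh; exists f.
have phiK f : G f -> phi (psi f) = f.
  move=> Gf; have [Gf' e] := hphi _ (iso_mem psi_iso Gf).
  exact: (iso_inj psi_iso) e.
exists phi => //; split; last first.
  move=> h k Hh Hk; have [Gh eh] := hphi _ Hh; have [Gk ek] := hphi _ Hk.
  by rewrite -{1}eh -{1}ek -(isoM psi_iso)// phiK//; exact: GM.
split.
- by move=> h Hh; have [] := hphi _ Hh.
- move=> h k; rewrite !inE => Hh Hk e.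
  by rewrite -(hphi _ Hh).2 -(hphi _ Hk).2 e.
- by move=> f Gf; exists (psi f); [exact: iso_mem psi_iso _ Gf|exact: phiK].
Qed.

Lemma corresponds_inv (phi : Aut mu -> Aut mu) A B :
  group_isomorphism H G phi -> (forall f, G f -> phi (psi f) = f) ->
  measurable A -> measurable B ->
  corresponds G psi A B -> corresponds H phi B A.
Proof.
move=> phi_iso phiK mA mB AB q Hq qq.
have [r Gr rq] := iso_surj psi_iso Hq; rewrite -rq phiK//.
have rr : (r * r = 1)%g.
  by apply/(iso_sqr1 (rich_subgroup richG) psi_iso Gr); rewrite rq.
have refl := corresponds_reflect sepE richG richH psi_iso.
split; first exact: refl AB Gr rr.
by apply: refl (correspondsC AB) Gr rr; exact: measurableC.
Qed.

End inverse.

(** * Realization by a point map *)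

Section metric.
Local Open Scope ring_scope.
Context (R : realType) (M : metricType R).

Definition rad (n : nat) : R := n.+1%:R^-1.

Lemma rad_gt0 n : 0 < rad n.
Proof. by rewrite invr_gt0. Qed.

Lemma rad_lt (e : R) : 0 < e -> exists N, forall n, (N <= n)%N -> rad n < e.
Proof.
move=> e0; have [N _ h] := near_infty_natSinv_lt (PosNum e0).
by exists N => n Nn; exact: h.
Qed.

Lemma mball_open (x : M) (e : R) : open [set y | mdist x y < e].
Proof.
rewrite openE => y /= xy; apply/nbhs_ballP.
exists (e - mdist x y) => /=; first by rewrite subr_gt0.
move=> z; rewrite ballEmdist /= => yz.
by rewrite (le_lt_trans (metric_triangle x y z))// -ltrBrDl.
Qed.

Lemma open_mball (U : set M) (x : M) : open U -> U x ->
  exists2 e : R, 0 < e & forall y, mdist x y < e -> U y.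
Proof.
rewrite openE => /(_ x)/[apply]; rewrite /interior/= => /nbhs_ballP[e e0 he].
by exists e => // y xy; apply: he; rewrite ballEmdist.
Qed.

Lemma dense_net (D : set M) : countable D -> dense D -> M ->
  exists a : nat -> M, forall z (e : R), 0 < e -> exists k, mdist (a k) z < e.
Proof.
move=> cD dD z0.
have net z (e : R) : 0 < e -> exists2 y, D y & mdist y z < e.
  move=> e0; have [|y [zy Dy]] := dD _ _ (mball_open z e).
    by exists z; rewrite /= mdistxx.
  by exists y; rewrite // metric_sym.
have [y0 Dy0 _] := net z0 1 ltr01.
have [a [_ Da]] := countable_enum cD Dy0.
exists a => z e /(net z)[y /Da[k <-] yz]; by exists k.
Qed.

(** The doubled radius leaves room for points that the ball of radius [rad n]
    around [a k] just misses. *)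
Definition inner_balls (a : nat -> M) (U : set M) : set (nat * nat) :=
  [set nk | forall y, mdist (a nk.2) y < rad nk.1 + rad nk.1 -> U y].

(** The balls that are hit decide on which side of an open set [z] lies: if [U]
    contains [z], it contains the doubled ball around a close enough center. *)
Lemma open_hitP (a : nat -> M) (hit : nat -> nat -> Prop) (z : M) (U : set M) :
  open U -> (forall n, exists k, hit n k) ->
  (forall n k, hit n k -> mdist (a k) z <= rad n) ->
  U z <-> exists2 nk, inner_balls a U nk & hit nk.1 nk.2.
Proof.
move=> oU hitn hitz; split=> [Uz|[[n k] /= Ink hnk]]; last first.
  apply: Ink; apply: le_lt_trans (hitz _ _ hnk) _.
  by rewrite ltrDl rad_gt0.
have [e e0 he] := open_mball oU Uz.
have [N /(_ N (leqnn N)) Ne] : exists N, forall n, (N <= n)%N -> rad n < e / 3.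
  by apply: rad_lt; rewrite divr_gt0.
have [k hk] := hitn N; exists (N, k) => //= y /= aky; apply: he.
apply: le_lt_trans (metric_triangle _ (a k) _) _.
by have := hitz _ _ hk; rewrite metric_sym; lra.
Qed.

(** The centers of balls that are hit form a Cauchy sequence, since the distance
    of two such centers is less than the sum of the radii. *)
Lemma shrinking_balls (a : nat -> M) (hit : nat -> nat -> Prop) :
  (forall F : set_system M, ProperFilter F -> cauchy F -> exists p : M, F --> p) ->
  (forall n, exists k, hit n k) ->
  (forall n m k l, hit n k -> hit m l -> mdist (a k) (a l) < rad n + rad m) ->
  exists z, forall n k, hit n k -> mdist (a k) z <= rad n.
Proof.
move=> complete /choice[c hc] meet.
have [|z cz] := complete (a \o c @ \oo) _.
  apply: cauchy_exP => e e0.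
  have [N Ne] : exists N, forall n, (N <= n)%N -> rad n < e / 2.
    by apply: rad_lt; rewrite divr_gt0.
  exists (a (c N)); exists N => // n /= Nn.
  rewrite ballEmdist/=; have := meet _ _ _ _ (hc N) (hc n).
  by have := Ne _ Nn; have := Ne _ (leqnn N); lra.
exists z => n k hnk; rewrite leNgt; apply/negP => nz.
pose e := mdist (a k) z - rad n.
have e0 : 0 < e by rewrite subr_gt0.
have e2 : 0 < e / 2 by rewrite divr_gt0.
have [N1 hN1] := rad_lt e2.
have [N2 _ hN2] := metricType_numDomainType.cvgr_dist_lt cz e2.
pose m := maxn N1 N2.
have h1 := hN1 m (leq_maxl _ _).
have h2 : mdist z (a (c m)) < e / 2 := hN2 m (leq_maxr N1 N2).
have h3 := meet _ _ _ _ hnk (hc m).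
have := metric_triangle (a k) (a (c m)) z; rewrite (metric_sym (a (c m))).
by rewrite /e in h1 h2; lra.
Qed.

End metric.

Section standard.
Local Open Scope ring_scope.
Context (R : realType) (d : measure_display) (X : measurableType d).
Context (mu : probability X R).
Implicit Types (A B C D : set X).

Lemma probability_inhabited : exists x : X, True.
Proof.
apply: contrapT => h; have : mu setT = 0%E.
  rewrite (_ : setT = set0) ?measure0//; apply/seteqP; split=> x // _.
  by apply: h; exists x.
by rewrite probability_setT => /eqP; rewrite onee_eq0.
Qed.

Lemma standard_borel_net : standard_borel R X -> exists (M : metricType R)
    (f : X -> M) (a : nat -> M),
  [/\ forall F : set_system M, ProperFilter F -> cauchy F ->
        exists p : M, F --> p,
      bijective f,
      forall A : set X,
        measurable A <-> exists2 B : set M, <<s open >> B & A = f @^-1` B &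
      forall z (e : R), 0 < e -> exists k, mdist (a k) z < e].
Proof.
move=> [M [f [complete [D cD dD] bf mX]]].
have [x0 _] := probability_inhabited.
have [a ha] := dense_net cD dD (f x0).
by exists M, f, a; split.
Qed.

Lemma standard_borel_separating : standard_borel R X ->
  exists E : nat -> set X, separating E.
Proof.
move=> /standard_borel_net[M [f [a [_ bf mX ha]]]].
pose E i := if unpickle i is Some (n, k) then
  f @^-1` [set y : M | mdist (a k) y < rad R n] else set0.
exists E; split=> [i|x y xy].
  rewrite /E; case: unpickle => // -[n k]; apply/mX.
  by exists [set y : M | mdist (a k) y < rad R n] => //; apply: sub_gen_smallest; exact: mball_open.
have fxy : 0 < mdist (f x) (f y).
  by rewrite mdist_gt0; apply/eqP => /(bij_inj bf).
have [N /(_ N (leqnn N)) hN] : exists N, forall n, (N <= n)%N -> rad R n < mdist (f x) (f y) / 2.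
  by apply: rad_lt; rewrite divr_gt0.
have [k hk] := ha (f x) _ (rad_gt0 R N).
exists (pickle (N, k)); rewrite /E pickleK /=; split=> // hy.
have := metric_triangle (f x) (a k) (f y); rewrite (metric_sym (f x) (a k)).
by lra.
Qed.

(** A homomorphism [rel] of measure algebras, given as a relation between
    representatives, is implemented by a point map: the images of the small
    balls around a dense sequence single out almost every point. *)
Lemma point_realization (rel : set X -> set X -> Prop) :
  standard_borel R X ->
  (forall A, measurable A -> exists2 B, measurable B & rel A B) ->
  rel setT setT ->
  (forall A B, rel A B -> rel (~` A) (~` B)) ->
  (forall A B : nat -> set X, (forall n, measurable (A n)) ->
    (forall n, measurable (B n)) -> (forall n, rel (A n) (B n)) ->
    rel (\bigcup_n A n) (\bigcup_n B n)) ->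
  (forall A A' B B', measurable A -> measurable B -> measurable B' ->
    rel A B -> rel A' B' -> A `<=[mu] A' -> B `<=[mu] B') ->
  exists2 Q : X -> X, measurable_fun setT Q &
    forall A B, measurable A -> measurable B -> rel A B ->
      \forall x \ae mu, A (Q x) <-> B x.
Proof.
move=> /standard_borel_net[M [f [a [complete bf mX ha]]]].
move=> rel_total relT relC relU rel_le.
have rel0 : rel set0 set0 by rewrite -setCT; exact: relC.
pose A nk := f @^-1` [set y : M | mdist (a nk.2) y < rad R nk.1].
have mf V : open V -> measurable (f @^-1` V).
  by move=> oV; apply/mX; exists V => //; exact: sub_gen_smallest.
have mA nk : measurable (A nk) by apply: mf; exact: mball_open.
have /choice[B hB] : forall nk, exists B, measurable B /\ rel (A nk) B.
  by move=> nk; have [B mB AB] := rel_total _ (mA nk); exists B.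
have rel_pairs (I : set (nat * nat)) :
    rel (\bigcup_(nk in I) A nk) (\bigcup_(nk in I) B nk) /\
    measurable (\bigcup_(nk in I) B nk).
  pose sel (F : nat * nat -> set X) i :=
    if unpickle i is Some nk then (if `[< I nk >] then F nk else set0) else set0.
  have selE F : \bigcup_(nk in I) F nk = \bigcup_i sel F i.
    apply/seteqP; split=> x.
      move=> [nk Ink Fx]; exists (pickle nk) => //.
      by rewrite /sel pickleK asboolT.
    move=> [i _]; rewrite /sel; case: unpickle => // nk.
    by case: asboolP => // Ink Fx; exists nk.
  have msel F : (forall nk, measurable (F nk)) -> forall i, measurable (sel F i).
    by move=> mF i; rewrite /sel; case: unpickle => // nk; case: asboolP.
  have mB nk : measurable (B nk) by have [] := hB nk.
  rewrite !selE; split; last by apply: bigcupT_measurable; exact: msel.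
  apply: relU => i; [exact: msel|exact: msel|].
  rewrite /sel; case: unpickle => // nk; case: asboolP => // _.
  by have [] := hB nk.
have hits : \forall x \ae mu, forall n, exists k, B (n, k) x.
  apply: ae_foralln => n.
  have [hr hm] := rel_pairs [set nk | nk.1 = n].
  have := rel_le _ _ _ _ measurableT measurableT hm relT hr.
  have sub : setT `<=[mu] \bigcup_(nk in [set nk | nk.1 = n]) A nk.
    apply: aeW => x _; have [k hk] := ha (f x) _ (rad_gt0 R n).
    by exists (n, k).
  move=> /(_ sub); apply: filterS => x /(_ I)[[m k] /= -> Bx].
  by exists k.
have meets : \forall x \ae mu, forall i : (nat * nat) * (nat * nat),
    B i.1 x -> B i.2 x -> mdist (a i.1.2) (a i.2.2) < rad R i.1.1 + rad R i.2.1.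
  apply: ae_forall_countable => -[[n k] [m l]] /=.
  have [h|h] := ltP (mdist (a k) (a l)) (rad R n + rad R m).
    exact: aeW.
  have [mB1 r1] := hB (n, k); have [mB2 r2] := hB (m, l).
  have := rel_le _ _ _ _ (mA (n, k)) mB1 (measurableC mB2) r1 (relC _ _ r2).
  have sub : A (n, k) `<=[mu] ~` A (m, l).
    apply: aeW => x /= h1 h2.
    have := metric_triangle (a k) (f x) (a l); rewrite (metric_sym (f x) (a l)).
    by move: h1 h2 h; rewrite /A/=; lra.
  by move=> /(_ sub); apply: filterS => x h1 h2 h3; exfalso; exact: h1 h2 h3.
have [N [mN N0 NZ]] := filterI hits meets.
pose Z := ~` N.
have mZ : measurable Z by exact: measurableC.
have Zae : \forall x \ae mu, Z x.
  by exists N; split=> // x /= /contrapT.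
have Zx x : Z x -> (forall n, exists k, B (n, k) x) /\
    (forall n m k l, B (n, k) x -> B (m, l) x ->
      mdist (a k) (a l) < rad R n + rad R m).
  move=> Nx; have /contrapT[h1 h2] := contra_not (@NZ x) Nx; split=> //.
  by move=> n m k l; exact: (h2 ((n, k), (m, l))).
have /choice[p hp] : forall x, exists z, Z x ->
    forall n k, B (n, k) x -> mdist (a k) z <= rad R n.
  move=> x; have [Zx'|nZ] := pselect (Z x); last by exists (f x).
  have [h1 h2] := Zx _ Zx'.
  have [z hz] := shrinking_balls complete h1 h2.
  by exists z.
have [finv fK finvK] := bf.
pose Q x := if `[< Z x >] then finv (p x) else x.
have fQ x : Z x -> f (Q x) = p x by move=> Zx'; rewrite /Q asboolT// finvK.
pose good := [set V : set M | measurable (f @^-1` V) /\ exists B,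
  [/\ measurable B, rel (f @^-1` V) B &
  forall x, Z x -> V (p x) <-> B x]].
have good_open : open `<=` good.
  move=> V oV; split; first exact: mf.
  have [hr hm] := rel_pairs (inner_balls a V).
  exists (\bigcup_(nk in inner_balls a V) B nk); split=> //.
    suff <- : \bigcup_(nk in inner_balls a V) A nk = f @^-1` V by [].
    apply/seteqP; split=> y /=.
      move=> [nk Ink /= h]; apply: Ink; apply: lt_le_trans h _.
      by rewrite lerDl ltW// rad_gt0.
    move=> Vy; have /(open_hitP oV) : forall n, exists k, mdist (a k) (f y) < rad R n.
      by move=> n; apply: ha; exact: rad_gt0.
    move=> /(_ a (f y)) [|h _]; first by move=> n k; exact: ltW.
    by have [nk Ink hnk] := h Vy; exists nk.
  move=> x Zx'; have [h1 _] := Zx _ Zx'.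
  rewrite (open_hitP oV h1 (hp _ Zx')).
  by split=> -[[n k] ? ?]; exists (n, k).
have good_sigma : sigma_algebra setT good.
  split.
  - by split; [rewrite preimage_set0|exists set0; split].
  - move=> V [mV [B0 [mB0 rB0 hB0]]]; rewrite setTD; split.
      by rewrite preimage_setC; exact: measurableC.
    exists (~` B0); split; [exact: measurableC|exact: relC|].
    by move=> x Zx'; have := hB0 _ Zx'; rewrite /=; tauto.
  - move=> V hV; have mV n : measurable (f @^-1` V n) by have [] := hV n.
    have /choice[B0 hB0] : forall n, exists B, [/\ measurable B,
        rel (f @^-1` V n) B & forall x, Z x -> V n (p x) <-> B x].
      by move=> n; have [] := hV n.
    have mB0 n : measurable (B0 n) by have [] := hB0 n.
    split; first by rewrite preimage_bigcup; exact: bigcupT_measurable.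
    exists (\bigcup_n B0 n); split; first exact: bigcupT_measurable.
      by rewrite preimage_bigcup; apply: relU => // n; have [] := hB0 n.
    by move=> x Zx'; split=> -[n _ h]; exists n => //;
      have [_ _ /(_ x Zx')[h1 h2]] := hB0 n; auto.
have all_good V : <<s open >> V -> good V.
  by apply: smallest_sub V => //.
have Q_good C : measurable C -> exists B, [/\ measurable B, rel C B &
    forall x, Z x -> C (Q x) <-> B x].
  move=> /mX[V /all_good[_ [B0 [mB0 rB0 hB0]]] ->].
  by exists B0; split=> // x Zx'; rewrite /= fQ//; exact: hB0.
exists Q.
  move=> _ C mC; rewrite setTI; have [B0 [mB0 _ hB0]] := Q_good _ mC.
  have -> : Q @^-1` C = (Z `&` B0) `|` (~` Z `&` C).
    apply/seteqP; split=> x /=.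
      have [Zx'|nZ] := pselect (Z x); first by move/hB0; left; split=> //; auto.
      by move=> CQ; right; split=> //; move: CQ; rewrite /Q asboolF.
    move=> [[Zx' /hB0]|[nZ Cx]]; first exact.
    by rewrite /Q asboolF.
  by apply: measurableU; apply: measurableI => //; exact: measurableC.
move=> C B1 mC mB1 rB1; have [B0 [mB0 rB0 hB0]] := Q_good _ mC.
have h1 := rel_le _ _ _ _ mC mB0 mB1 rB0 rB1 (aeW _ (fun x h => h)).
have h2 := rel_le _ _ _ _ mC mB1 mB0 rB1 rB0 (aeW _ (fun x h => h)).
apply: filterS3 Zae h1 h2 => x Zx' h1 h2; have := hB0 x Zx'; tauto.
Qed.

End standard.

Section almost_bijection.
Context (R : realType) (d : measure_display) (X : measurableType d).
Context (mu : probability X R).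
Implicit Types (A B C D : set X).

Lemma measurable_forall_countable (I : countType) (P : I -> set X) :
  (forall i, measurable (P i)) -> measurable [set x | forall i, P i x].
Proof.
move=> mP; pose Q n := if unpickle n is Some i then P i else setT.
have -> : [set x | forall i, P i x] = \bigcap_n Q n.
  apply/seteqP; split=> x /= h.
    by move=> n _; rewrite /Q; case: unpickle.
  by move=> i; have := h (pickle i) Logic.I; rewrite /Q pickleK.
by apply: bigcapT_measurable => n; rewrite /Q; case: unpickle.
Qed.

Context (E : nat -> set X) (sepE : separating E).

(** Two maps that are almost everywhere inverse to each other restrict to
    inverse bijections of the set of points from which no word in the two maps
    leads to a point where they fail to be inverse; the points outside this
    conull set may as well be fixed. *)
Lemma almost_bijection (S Q : X -> X) :
  measurable_fun setT S -> measurable_fun setT Q ->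
  (\forall x \ae mu, Q (S x) = x) -> (\forall x \ae mu, S (Q x) = x) ->
  (forall P : X -> Prop, (\forall x \ae mu, P x) -> \forall x \ae mu, P (Q x)) ->
  (forall A, measurable A -> mu (S @^-1` A) = mu A) ->
  exists f : mp_bijection mu,
    (\forall x \ae mu, f x = S x) /\ (\forall x \ae mu, mp_inv f x = Q x).
Proof.
move=> mS mQ QS SQ aeQ muS.
have aeS (P : X -> Prop) : (\forall x \ae mu, P x) -> \forall x \ae mu, P (S x).
  move=> [N [mN N0 NP]]; exists (S @^-1` N); split; last by move=> x nP; exact: NP.
  - exact: measurable_preimageT.
  - by rewrite muS.
pose run (w : seq bool) x := foldr (fun b : bool => if b then S else Q) x w.
pose ok := [set x | Q (S x) = x] `&` [set x | S (Q x) = x].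
pose X0 := [set x | forall w, ok (run w x)].
have mrun w : measurable_fun setT (run w).
  elim: w => [|b w IHw] /=; first exact: measurable_id.
  by case: b; apply: measurableT_comp IHw.
have mok : measurable ok.
  have eqC (h : X -> X) : measurable_fun setT h -> measurable [set x | h x = x].
    move=> mh; have -> : [set x | h x = x] = ~` (setT `&` [set x | h x <> id x]).
      by apply/seteqP; split=> x /= => [-> []//|n]; apply: contrapT => h'; exact: n.
    by apply: measurableC; apply: (measurable_neq sepE) => //; exact: measurable_id.
  by apply: measurableI; apply: eqC; exact: measurableT_comp.
have mX0 : measurable X0.
  apply: (@measurable_forall_countable _ (fun w => run w @^-1` ok)) => w.
  exact: measurable_preimageT.
have aeX0 : \forall x \ae mu, X0 x.
  apply: ae_forall_countable; elim/last_ind => [|w b IHw].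
    by apply: filterS2 QS SQ => x; split.
  have runE x : run (rcons w b) x = run w (if b then S x else Q x).
    by rewrite /run foldr_rcons; case: b.
  by case: b runE => runE; [apply: filterS (aeS _ IHw)|apply: filterS (aeQ _ IHw)]
    => x h; rewrite runE.
have runS w x : run w (S x) = run (rcons w true) x by rewrite /run foldr_rcons.
have runQ w x : run w (Q x) = run (rcons w false) x by rewrite /run foldr_rcons.
have X0S x : X0 x -> X0 (S x) by move=> h w; rewrite runS; exact: h.
have X0Q x : X0 x -> X0 (Q x) by move=> h w; rewrite runQ; exact: h.
pose onX0 (h : X -> X) x := if `[< X0 x >] then h x else x.
have onX0K (h k : X -> X) : (forall x, X0 x -> X0 (h x)) ->
    (forall x, X0 x -> k (h x) = x) -> cancel (onX0 h) (onX0 k).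
  move=> hX0 kh x; rewrite /onX0; have [Xx|nXx] := pselect (X0 x).
    by rewrite (asboolT Xx) asboolT ?kh//; exact: hX0.
  by rewrite !asboolF.
have m_onX0 (h : X -> X) : measurable_fun setT h -> measurable_fun setT (onX0 h).
  move=> mh _ A mA; rewrite setTI.
  have -> : onX0 h @^-1` A = (X0 `&` h @^-1` A) `|` (~` X0 `&` A).
    apply/seteqP; split=> x; rewrite /onX0 /=.
      by case: asboolP => Xx hA; [left|right].
    by case: asboolP => Xx [] [].
  apply: measurableU; apply: measurableI => //; last exact: measurableC.
  exact: measurable_preimageT.
have ae_onX0 (h : X -> X) : \forall x \ae mu, onX0 h x = h x.
  by apply: filterS aeX0 => x Xx; rewrite /onX0 asboolT.
have SQK : cancel (onX0 S) (onX0 Q).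
  by apply: onX0K => // x /(_ [::])[].
have QSK : cancel (onX0 Q) (onX0 S).
  by apply: onX0K => // x /(_ [::])[].
have muf A : measurable A -> mu (onX0 S @^-1` A) = mu A.
  move=> mA; rewrite -(muS A mA); apply: measure_ae_eq.
  - by apply: measurable_preimageT => //; exact: m_onX0.
  - exact: measurable_preimageT.
  - by apply: filterS (ae_onX0 S) => x /= ->.
by exists (MPBijection SQK QSK (m_onX0 _ mS) (m_onX0 _ mQ) muf); split => /=;
  exact: ae_onX0.
Qed.

End almost_bijection.

(** * Partial isomorphisms *)

Section partial_isomorphisms.
Context (R : realType) (d : measure_display) (X : measurableType d).
Context (mu : probability X R).
Implicit Types (A B C D : set X) (f g : partial_iso mu).

Lemma pfun_rng f x : dom f x -> rng f (f x).
Proof. by have [h _ _] := pfun_bij f; exact: h. Qed.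

Lemma pfun_inj f x y : dom f x -> dom f y -> f x = f y -> x = y.
Proof. by have [_ h _] := pfun_bij f => fx fy; apply: h; rewrite inE. Qed.

Lemma pfun_surj f y : rng f y -> exists2 x, dom f x & f x = y.
Proof. by have [_ _ h] := pfun_bij f => /h[x ? <-]; exists x. Qed.

Lemma measurable_dom_preimage f A : measurable A ->
  measurable (dom f `&` f @^-1` A).
Proof. by move=> mA; apply: measurable_pfun => //; exact: measurable_dom. Qed.

Lemma partial_id_exists :
  exists f : partial_iso mu, dom f = setT /\ forall x, f x = x.
Proof.
have bij : set_bij setT setT (@idfun X).
  by split=> // x _; exists x.
have im A : measurable A -> A `<=` setT -> measurable (@idfun X @` A).
  by rewrite image_id.
have pres A : measurable A -> A `<=` setT -> mu (@idfun X @` A) = mu A.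
  by rewrite image_id.
by exists (PartialIso measurableT measurableT bij (@measurable_id _ X setT) im pres).
Qed.

Lemma partial_comp_exists g f : exists h : partial_iso mu,
  dom h = dom f `&` f @^-1` dom g /\ forall x, h x = g (f x).
Proof.
have im A : A `<=` dom f `&` f @^-1` dom g ->
    (fun x => g (f x)) @` A = g @` (f @` A).
  by move=> _; rewrite -(image_comp f g).
have subg A : A `<=` dom f `&` f @^-1` dom g -> f @` A `<=` dom g.
  by move=> Afg _ [x /Afg[_ ?] <-].
have subf A : A `<=` dom f `&` f @^-1` dom g -> A `<=` dom f.
  by move=> Afg x /Afg[].
have mf A : measurable A -> A `<=` dom f `&` f @^-1` dom g ->
    measurable (f @` A).
  by move=> mA Afg; apply: measurable_pfun_image => //; exact: subf.
have bij : set_bij (dom f `&` f @^-1` dom g) (g @` (rng f `&` dom g))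
    (fun x => g (f x)).
  split.
  - by move=> x [fx gx]; exists (f x) => //; split=> //; exact: pfun_rng.
  - move=> x y; rewrite !inE => -[fx gx] [fy gy] e.
    by apply: (pfun_inj fx fy); exact: (pfun_inj gx gy).
  - by move=> _ [z [/pfun_surj[x fx <-] gz] <-]; exists x.
have mdom : measurable (dom f `&` f @^-1` dom g).
  by apply: measurable_dom_preimage; exact: measurable_dom.
have mrng : measurable (g @` (rng f `&` dom g)).
  apply: measurable_pfun_image; last by move=> x [].
  by apply: measurableI; [exact: measurable_rng|exact: measurable_dom].
have mcomp : measurable_fun (dom f `&` f @^-1` dom g) (fun x => g (f x)).
  move=> _ A mA; rewrite -setIA.
  apply: (@measurable_dom_preimage f (dom g `&` g @^-1` A)).
  exact: measurable_dom_preimage.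
have mim A : measurable A -> A `<=` dom f `&` f @^-1` dom g ->
    measurable ((fun x => g (f x)) @` A).
  move=> mA Afg; rewrite im//; apply: measurable_pfun_image; first exact: mf.
  exact: subg.
have pres A : measurable A -> A `<=` dom f `&` f @^-1` dom g ->
    mu ((fun x => g (f x)) @` A) = mu A.
  move=> mA Afg; rewrite im// pfun_preserving; [|exact: mf|exact: subg].
  by apply: pfun_preserving => //; exact: subf.
by exists (PartialIso mdom mrng bij mcomp mim pres).
Qed.

Lemma partial_inv_exists f : exists h : partial_iso mu,
  [/\ dom h = rng f, rng h = dom f,
      forall x, dom f x -> h (f x) = x & forall y, rng f y -> f (h y) = y].
Proof.
have /choice[h hP] : forall y, exists x, rng f y -> dom f x /\ f x = y.
  move=> y; have [fy|nfy] := pselect (rng f y); last by exists y.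
  by have [x fx xy] := pfun_surj fy; exists x.
have hK x : dom f x -> h (f x) = x.
  move=> fx; have [fhx e] := hP _ (pfun_rng fx); exact: pfun_inj fhx fx e.
have bij : set_bij (rng f) (dom f) h.
  split.
  - by move=> y /hP[].
  - by move=> y z; rewrite !inE => /hP[_ {2}<-] /hP[_ {2}<-] ->.
  - by move=> x fx; exists (f x); [exact: pfun_rng|exact: hK].
have him A : A `<=` rng f -> h @` A = dom f `&` f @^-1` A.
  move=> Af; apply/seteqP; split=> [_ [y Ay <-]|x [fx Afx]].
    by have [fh e] := hP _ (Af _ Ay); split=> //=; rewrite e.
  by exists (f x) => //; exact: hK.
have mh : measurable_fun (rng f) h.
  move=> _ A mA.
  have -> : rng f `&` h @^-1` A = f @` (dom f `&` A).
    apply/seteqP; split=> [y [fy Ay]|_ [x [fx Ax] <-]].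
      by have [fh e] := hP _ fy; exists (h y).
    by split; [exact: pfun_rng|rewrite /= hK].
  apply: measurable_pfun_image; last by move=> x [].
  by apply: measurableI => //; exact: measurable_dom.
have mim A : measurable A -> A `<=` rng f -> measurable (h @` A).
  by move=> mA Af; rewrite him//; exact: measurable_dom_preimage.
have pres A : measurable A -> A `<=` rng f -> mu (h @` A) = mu A.
  move=> mA Af; rewrite him//.
  have := @pfun_preserving _ _ _ _ f _ (measurable_dom_preimage f mA) (@subIsetl _ _ _).
  move=> <-; congr (mu _); apply/seteqP; split=> [_ [x [fx Afx] <-]//|y Ay].
  by have [fh e] := hP _ (Af _ Ay); exists (h y) => //; split=> //=; rewrite e.
exists (PartialIso (measurable_rng f) (measurable_dom f) bij mh mim pres).
by split=> //= y fy; have [] := hP y fy.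
Qed.

(** All involutions built below arise in this way, whether they are cut from
    another involution or made from a word in a graphing. *)
Lemma swap_exists f D : measurable D -> D `<=` dom f ->
  (forall x y, D x -> D y -> f x <> y) ->
  exists t : mp_bijection mu, [/\ forall x, t (t x) = x,
    forall x, D x -> t x = f x, forall x, D x -> t (f x) = x &
    forall x, ~ D x -> ~ (f @` D) x -> t x = x].
Proof.
move=> mD Df fD.
have [h [hdom hrng hK fK]] := partial_inv_exists f.
pose t x := if `[< D x >] then f x else if `[< (f @` D) x >] then h x else x.
have tD x : D x -> t x = f x by move=> Dx; rewrite /t asboolT.
have tfD x : D x -> t (f x) = x.
  move=> Dx; rewrite /t asboolF; last by move=> /(fD _ _ Dx).
  have fDx : (f @` D) (f x) by exists x.
  by rewrite (asboolT fDx) hK//; exact: Df.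
have tE x : ~ D x -> ~ (f @` D) x -> t x = x.
  by move=> nD nfD; rewrite /t !asboolF.
have tt : involutive t.
  move=> x; have [Dx|nD] := pselect (D x); first by rewrite (tD x)// tfD.
  have [[y Dy <-]|nfD] := pselect ((f @` D) x); first by rewrite tfD// tD.
  by rewrite (tE x)// tE.
have mfD : measurable (f @` D) by exact: measurable_pfun_image.
have preE A : t @^-1` A =
    (D `&` (dom f `&` f @^-1` A)) `|` f @` (D `&` A) `|` (~` (D `|` f @` D) `&` A).
  apply/seteqP; split=> x /=.
    have [Dx|nD] := pselect (D x).
      by rewrite tD// => Afx; left; left; split=> //; split=> //; exact: Df.
    have [[y Dy <-]|nfD] := pselect ((f @` D) x).
      by rewrite tfD// => Ay; left; right; exists y.
    by rewrite tE// => Ax; right; split=> // -[].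
  move=> [[[Dx [_ ?]]|[y [Dy Ay] <-]]|[/not_orP[nD nfD] Ax]].
  - by rewrite tD.
  - by rewrite tfD.
  - by rewrite tE.
have mfDA A : measurable A -> measurable (f @` (D `&` A)).
  move=> mA; apply: measurable_pfun_image; first exact: measurableI.
  by move=> x [/Df].
have mDf A : measurable A -> measurable (D `&` (dom f `&` f @^-1` A)).
  by move=> mA; apply: measurableI => //; exact: measurable_dom_preimage.
have mrest A : measurable A -> measurable (~` (D `|` f @` D) `&` A).
  by move=> mA; apply: measurableI => //; apply/measurableC/measurableU.
have mt : measurable_fun setT t.
  move=> _ A mA; rewrite setTI preE; apply: measurableU; last exact: mrest.
  by apply: measurableU; [exact: mDf|exact: mfDA].
have measureU3 A B C : measurable A -> measurable B -> measurable C ->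
    A `&` B = set0 -> (A `|` B) `&` C = set0 ->
    mu (A `|` B `|` C) = mu A + mu B + mu C.
  move=> mA mB mC AB ABC; rewrite measureU//; last exact: measurableU.
  by congr (_ + _); exact: measureU.
have mut A : measurable A -> mu (t @^-1` A) = mu A.
  move=> mA; rewrite preE measureU3.
  - have -> : mu (D `&` (dom f `&` f @^-1` A)) = mu (f @` D `&` A).
      rewrite -(@pfun_preserving _ _ _ _ f _ (mDf _ mA)); last by move=> x [/Df].
      congr (mu _); apply/seteqP; split=> [_ [x [Dx [_ Ax]] <-]|_ [[x Dx <-] Ax]].
        by split=> //; exists x.
      by exists x => //; split=> //; split=> //; exact: Df.
    have -> : mu (f @` (D `&` A)) = mu (D `&` A).
      by apply: pfun_preserving; [exact: measurableI|move=> x [/Df]].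
    rewrite -measureU3.
    + congr (mu _); apply/seteqP; split=> x; first by move=> [[]|] [].
      have [Dx|nD] := pselect (D x); first by left; right.
      have [fDx|nfD] := pselect ((f @` D) x); first by left; left.
      by right; split=> // -[].
    + exact: measurableI.
    + exact: measurableI.
    + exact: mrest.
    + by apply/seteqP; split=> x // [[[y Dy e] _] [Dx _]]; exact: fD Dy Dx e.
    + apply/seteqP; split=> x // [[[fDx _]|[Dx _]] [n _]]; apply: n; first by right.
      by left.
  - exact: mDf.
  - exact: mfDA.
  - exact: mrest.
  - by apply/seteqP; split=> x // [[Dx _] [y [Dy _] e]]; exact: fD Dy Dx e.
  - apply/seteqP; split=> x // [[[Dx _]|[y [Dy _] <-]] [n _]]; apply: n; first by left.
    by right; exists y.
by exists (MPBijection tt tt mt mt mut).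
Qed.

End partial_isomorphisms.

(** * Words in a graphing and the graph distance *)

Section words.
Context (R : realType) (d : measure_display) (X : measurableType d).
Context (mu : probability X R) (Phi : graphing mu).
Implicit Types (f g : partial_iso mu) (x y z : X).

Lemma graphing_path_trans n m x y z : graphing_path Phi n x y ->
  graphing_path Phi m y z -> graphing_path Phi (n + m) x z.
Proof.
elim: m z => [|m IHm] z pxy /=; first by move=> <-; rewrite addn0.
by move=> [u pu uz]; rewrite addnS; exists u => //; exact: IHm.
Qed.

Lemma graphing_step_sym x y : graphing_step Phi x y -> graphing_step Phi y x.
Proof. by move=> [f Ff h]; exists f => //; tauto. Qed.

Lemma graphing_path1 x y : graphing_step Phi x y -> graphing_path Phi 1 x y.
Proof. by move=> h; exists x. Qed.

Lemma graphing_path_sym n x y : graphing_path Phi n x y -> graphing_path Phi n y x.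
Proof.
elim: n y => [|n IHn] y /=; first by move=> ->.
move=> [z /IHn zx /graphing_step_sym/graphing_path1 yz].
by have := graphing_path_trans yz zx; rewrite add1n.
Qed.

Lemma orbit_relP x y : orbit_rel Phi x y <-> exists n, graphing_path Phi n x y.
Proof.
split.
  elim=> {x y} [x y [f Ff xy]|x|x y _ [n h]|x y z _ [n hn] _ [m hm]].
  - by exists 1%N; apply: graphing_path1; exists f => //; left.
  - by exists 0%N.
  - by exists n; exact: graphing_path_sym.
  - by exists (n + m)%N; exact: graphing_path_trans hn hm.
move=> [n]; elim: n y => [|n IHn] y /=; first by move=> ->; exact: rst_refl.
move=> [z /IHn xz [f Ff zy]]; apply: rst_trans xz _.
case: zy => zy; first by apply: rst_step; exists f.
by apply: rst_sym; apply: rst_step; exists f.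
Qed.

(** The second components are the words in the graphing and its inverses, as
    partial isomorphisms; the first components are their lengths. *)
Definition enumerates_words (e : nat -> nat * partial_iso mu) : Prop :=
  forall n x y, graphing_path Phi n x y <->
    exists2 i, (e i).1 = n & dom (e i).2 x /\ (e i).2 x = y.

Lemma words_countable : exists e, enumerates_words e.
Proof.
have /choice[inv invP] := @partial_inv_exists R d X mu.
have /choice[comp compP] : forall gf : partial_iso mu * partial_iso mu,
    exists h : partial_iso mu, dom h = dom gf.2 `&` gf.2 @^-1` dom gf.1 /\
      forall x, h x = gf.1 (gf.2 x).
  by move=> [g f]; exact: partial_comp_exists.
have [pid [pid_dom pidE]] := partial_id_exists mu.
pose L := graphing_set Phi `|` inv @` graphing_set Phi.
have cL : countable L.
  rewrite /L -bigcup2inE; apply: bigcup_countable; first exact: countableP.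
  move=> [|[|i]] //= _; first exact: countable_graphing.
  exact: sub_countable (card_image_le _ _) (countable_graphing Phi).
have stepE x y : graphing_step Phi x y <-> exists2 l, L l & dom l x /\ l x = y.
  split=> [[f Ff [[fx <-]|[fy <-]]]|[l [Fl|[f Ff <-]] [lx <-]]].
  - by exists f => //; left.
  - have [id ir hK _] := invP f; exists (inv f); first by right; exists f.
    by rewrite id hK//; split=> //; exact: pfun_rng.
  - by exists l => //; left.
  - have [id ir hK fK] := invP f; exists f => //; right.
    move: lx; rewrite id => fx; rewrite fK//; split=> //.
    by have [z fz <-] := pfun_surj fx; rewrite hK.
pose W := fix W n : set (partial_iso mu) :=
  if n is n'.+1 then comp @` (L `*` W n') else [set pid].
have cW n : countable (W n).
  elim: n => [|n IHn] /=; first exact: countable1.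
  by apply: sub_countable (card_image_le _ _) _; exact: countableX.
have WP n x y : graphing_path Phi n x y <-> exists2 w, W n w & dom w x /\ w x = y.
  elim: n y => [|n IHn] y /=.
    split=> [->|[_ -> [_ <-]]]; last by rewrite pidE.
    by exists pid => //; rewrite pid_dom pidE.
  split=> [[z /IHn[w Ww [wx wz]] /stepE[l Ll [lz ly]]]|].
    exists (comp (l, w)); first by exists (l, w).
    have [-> ->] := compP (l, w); rewrite /= wz; split=> //; split=> //=.
  move=> [_ [[l w] [/= Ll Ww] <-]]; have [-> ->] := compP (l, w).
  move=> /= [[wx lwx] ly]; exists (w x); first by apply/IHn; exists w.
  by apply/stepE; exists l.
pose P := \bigcup_n [set (n, w) | w in W n].
have cP : countable P.
  apply: bigcup_countable => // n _.
  exact: sub_countable (card_image_le _ _) (cW n).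
have P0 : P (0%N, pid) by exists 0%N => //; exists pid.
have [e [eP Pe]] := countable_enum cP P0; exists e => n x y.
rewrite WP; split=> [[w Ww wxy]|[i ein wxy]].
  have [|i ei] := Pe (n, w); first by exists n => //; exists w.
  by exists i; rewrite ei.
have [m _ [w Ww mw]] := eP i; rewrite -mw /= in ein wxy.
by exists w => //; rewrite -ein.
Qed.

Lemma graphing_dist_attained x y :
  (exists2 n, graphing_path Phi n x y & graphing_dist Phi x y = n%:R%:E) \/
  graphing_dist Phi x y = +oo.
Proof.
have [[m pm]|np] := pselect (exists m, graphing_path Phi m x y); last first.
  right; rewrite /graphing_dist -[RHS]ereal_inf0; congr ereal_inf.
  by apply/seteqP; split=> z // [n pn _]; apply: np; exists n.
left; have ex : exists n, `[< graphing_path Phi n x y >].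
  by exists m; apply/asboolP.
case: (ex_minnP ex) => n /asboolP pn n_min; exists n => //.
apply/eqP; rewrite eq_le; apply/andP; split.
  by apply: ereal_inf_lbound; exists n.
apply: le_ereal_inf_tmp => _ [k pk <-]; rewrite lee_fin ler_nat.
by apply: n_min; apply/asboolP.
Qed.

Lemma graphing_dist_le n x y : graphing_path Phi n x y ->
  graphing_dist Phi x y <= n%:R%:E.
Proof. by move=> p; apply: ereal_inf_lbound; exists n. Qed.

Lemma graphing_dist_ge0 x y : 0 <= graphing_dist Phi x y.
Proof. by apply: le_ereal_inf_tmp => _ [n _ <-]; rewrite lee_fin. Qed.

Lemma graphing_distxx x : graphing_dist Phi x x = 0.
Proof.
apply/eqP; rewrite eq_le graphing_dist_ge0 andbT.
exact: (@graphing_dist_le 0).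
Qed.

Lemma graphing_dist_sym x y : graphing_dist Phi x y = graphing_dist Phi y x.
Proof.
congr ereal_inf; apply/seteqP; split=> _ [n pn <-]; exists n => //;
  exact: graphing_path_sym.
Qed.

Lemma graphing_dist_triangle x y z :
  graphing_dist Phi x z <= graphing_dist Phi x y + graphing_dist Phi y z.
Proof.
have [[n pn ->]|->] := graphing_dist_attained x y; last first.
  by rewrite addye ?leey// gt_eqF// (lt_le_trans _ (graphing_dist_ge0 _ _)).
have [[m pm ->]|->] := graphing_dist_attained y z; last first.
  by rewrite addey ?leey.
rewrite -EFinD -natrD; apply: graphing_dist_le.
exact: graphing_path_trans pn pm.
Qed.

Context (E : nat -> set X) (sepE : separating E).

(** The distance is the infimum, over the countably many words, of the functions
    equal to the length where the word agrees with [T] and to [+oo] elsewhere. *)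
Lemma measurable_graphing_dist (T : X -> X) : measurable_fun setT T ->
  measurable_fun setT (fun x => graphing_dist Phi x (T x)).
Proof.
move=> mT; have [e eP] := words_countable.
pose D i := dom (e i).2 `&` [set x | (e i).2 x = T x].
have mD i : measurable (D i).
  have -> : D i = dom (e i).2 `\` (dom (e i).2 `&` [set x | (e i).2 x <> T x]).
    apply/seteqP; split=> x [hx h]; split=> //; first by case.
    by apply: contrapT => n; apply: h.
  apply: measurableD; first exact: measurable_dom.
  apply: (measurable_neq sepE) => //; [exact: measurable_dom|exact: measurable_pfun|].
  exact: measurable_funTS.
pose h i x : \bar R := if x \in D i then (e i).1%:R%:E else +oo.
have -> : (fun x => graphing_dist Phi x (T x)) = (fun x => einfs (h ^~ x) 0%N).
  apply/funext => x; rewrite /einfs /=; apply/eqP; rewrite eq_le; apply/andP; split.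
    apply: le_ereal_inf_tmp => _ [i _ <-]; rewrite /h.
    case: ifPn => [|_]; last by rewrite leey.
    by rewrite inE => Dx; apply: graphing_dist_le; apply/eP; exists i.
  apply: le_ereal_inf_tmp => _ [n /eP[i ein Dx] <-].
  apply: ereal_inf_lbound; exists i => //=.
  by rewrite /h mem_set// ein.
apply: measurable_fun_einfs => i; apply: measurable_fun_ifT => //.
by apply: (measurable_fun_bool true); rewrite setTI preimage_mem_true.
Qed.

End words.

(** * The L1 full group of an ergodic graphing *)

Section L1_full_group.
Context (R : realType) (d : measure_display) (X : measurableType d).
Context (mu : probability X R) (Phi : graphing mu).
Implicit Types (x y z : X) (A B C D : set X) (S T p : Aut mu).
Context (E : nat -> set X) (sepE : separating E).

Local Notation dist := (graphing_dist Phi).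
Local Notation G := (L1_full_group Phi).

Let mdistT T : measurable_fun setT (fun x => dist x (T x)).
Proof. by apply: measurable_graphing_dist sepE _ _; exact: measurable_aut. Qed.

Lemma L1_full_group_bound T (h : X -> \bar R) : measurable_fun setT h ->
  (forall x, 0 <= h x) -> \int[mu]_x h x < +oo ->
  (\forall x \ae mu, orbit_rel Phi x (T x)) ->
  (\forall x \ae mu, dist x (T x) <= h x) -> G T.
Proof.
move=> mh h0 hoo orb le_h; split=> //; apply: le_lt_trans hoo.
apply: ae_ge0_le_integral => //.
- by move=> x _; exact: graphing_dist_ge0.
- by apply: filterS le_h.
Qed.

Lemma integral_aut T (h : X -> \bar R) : measurable_fun setT h ->
  (forall x, 0 <= h x) -> \int[mu]_x h (T x) = \int[mu]_x h x.
Proof.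
move=> mh h0; have <- : \int[pushforward mu T]_x h x = \int[mu]_x h x.
  pose mT := isMeasurableFun.Build _ _ _ _ _ (measurable_aut T).
  pose fT : {mfun X >-> X} := HB.pack (T : X -> X) mT.
  apply: (@eq_measure_integral _ _ _ _ mu (pushforward mu fT)) => A mA _.
  exact: (mp_preserving (repr T)).
by rewrite ge0_integral_pushforward//; exact: measurable_aut.
Qed.

Lemma L1_full_group_subgroup : is_subgroup G.
Proof.
split.
- apply: (@L1_full_group_bound _ (cst 0)) => //.
  + by rewrite integral0.
  + by apply: filterS (ae_oneE mu) => x ->; apply/orbit_relP; exists 0%N.
  + by apply: filterS (ae_oneE mu) => x ->; rewrite graphing_distxx.
- suff closedM (S T : Aut mu) : G S -> G T -> G (S * T)%g.
    by move=> S T; exact: closedM.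
  move=> [oS iS] [oT iT].
  have mST : measurable_fun setT (fun x => dist (T x) (S (T x))).
    exact: (measurableT_comp (mdistT S) (measurable_aut T)).
  apply: (@L1_full_group_bound _ (fun x => dist x (T x) + dist (T x) (S (T x)))).
  + exact: emeasurable_funD.
  + by move=> x; rewrite adde_ge0// graphing_dist_ge0.
  + rewrite ge0_integralD//; last 2 first.
      by move=> x _; exact: graphing_dist_ge0.
      by move=> x _; exact: graphing_dist_ge0.
    rewrite (integral_aut T (mdistT S)); last by move=> x; exact: graphing_dist_ge0.
    exact: lte_add_pinfty.
  + apply: filterS3 oT (ae_aut T oS) (ae_mulE S T) => x h1 h2 ->.
    exact: rst_trans h1 h2.
  + by apply: filterS (ae_mulE S T) => x ->; exact: graphing_dist_triangle.
- suff closedV (T : Aut mu) : G T -> G (T^-1)%g by move=> T; exact: closedV.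
  move=> [oT iT].
  apply: (@L1_full_group_bound _
    (fun x => dist ((T^-1 : Aut mu)%g x) (T ((T^-1 : Aut mu)%g x)))).
  + exact: (measurableT_comp (mdistT T) (measurable_aut T^-1%g)).
  + by move=> x; exact: graphing_dist_ge0.
  + by rewrite (integral_aut T^-1%g (mdistT T))// => x; exact: graphing_dist_ge0.
  + apply: filterS2 (ae_aut T^-1%g oT) (ae_invKV T) => x h xx.
    by apply: rst_sym; rewrite xx in h.
  + by apply: filterS (ae_invKV T) => x xx; rewrite xx graphing_dist_sym.
Qed.

(** The restriction moves a point as [p] does or not at all, so its displacement
    is at most that of [p]. *)
Lemma L1_full_group_cut p D : G p -> (p * p = 1)%g -> measurable D ->
  (forall x y, D x -> D y -> p x <> y) ->
  exists2 t, G t & \forall x \ae mu,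
    (D x \/ D (p x) -> t x = p x) /\ (~ (D x \/ D (p x)) -> t x = x).
Proof.
move=> [op ip] pp mD pD.
pose q : mp_bijection mu := repr p.
have bij : set_bij setT setT q.
  split=> //; first by move=> x y _ _; exact: (can_inj (mp_funK q)).
  by move=> x _; exists (mp_inv q x) => //; exact: mp_invK.
have imE A : q @` A = mp_inv q @^-1` A.
  apply/seteqP; split=> [_ [x Ax <-]|x Ax]; first by rewrite /= mp_funK.
  by exists (mp_inv q x) => //; exact: mp_invK.
have mim A : measurable A -> A `<=` setT -> measurable (q @` A).
  move=> mA _; rewrite imE -[X in measurable X]setTI.
  exact: measurable_mp_inv.
have pres A : measurable A -> A `<=` setT -> mu (q @` A) = mu A.
  move=> mA AT; rewrite -(mp_preserving q (mim _ mA AT)); congr (mu _).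
  apply/seteqP; split=> x /=; last by exists x.
  by move=> [y Ay /(can_inj (mp_funK q)) <-].
have [f [_ fD ffD fE]] := @swap_exists _ _ _ mu
  (PartialIso measurableT measurableT bij (measurable_mp_fun q) mim pres) D mD
  (@subsetT _ D) pD.
exists (aut_of f).
  have tE : \forall x \ae mu, aut_of f x = x \/ aut_of f x = p x.
    apply: filterS2 (aut_ofK f) (ae_invol pp) => x /(_ Logic.I) -> ppx.
    have [/fD ->|nD] := pselect (D x); first by right.
    have [[y Dy yx]|nfD] := pselect ((q @` D) x); last by left; exact: fE.
    right; rewrite -[in LHS]yx ffD//; apply: (@aut_inj _ _ _ _ p).
    by rewrite ppx.
  apply: (@L1_full_group_bound _ (fun x => dist x (p x))) => //.
  - by move=> x; exact: graphing_dist_ge0.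
  - apply: filterS2 tE op => x [] -> // _.
    by apply/orbit_relP; exists 0%N.
  - apply: filterS tE => x [] -> //.
    by rewrite graphing_distxx graphing_dist_ge0.
apply: filterS2 (aut_ofK f) (ae_invol pp) => x /(_ Logic.I) -> ppx; split.
  move=> [/fD//|Dpx]; rewrite -[in LHS]ppx; exact: ffD.
move=> /not_orP[nD nDp]; apply: fE => // -[y Dy yx]; apply: nDp.
have -> // : p x = y.
by apply: (@aut_inj _ _ _ _ p); rewrite ppx -yx.
Qed.

Context (e : nat -> nat * partial_iso mu) (eP : enumerates_words Phi e).

(** A word in the graphing moves points by at most its length, so the involution
    swapping along it has a bounded displacement. *)
Lemma L1_full_group_swap i D : measurable D -> D `<=` dom (e i).2 ->
  (forall x y, D x -> D y -> (e i).2 x <> y) ->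
  exists t, [/\ G t, (t * t = 1)%g,
    \forall x \ae mu, D x -> t x = (e i).2 x,
    \forall x \ae mu, ((e i).2 @` D) (t x) <-> D x &
    supp t `<=[mu] D `|` (e i).2 @` D].
Proof.
move=> mD De eD; have [f [ff fD feD fE]] := swap_exists mD De eD.
have fK := aut_ofK f.
have pathD x : D x -> graphing_path Phi (e i).1 x ((e i).2 x).
  by move=> Dx; apply/eP; exists i => //; split=> //; exact: De.
have pathf x : graphing_path Phi (e i).1 x (f x) \/ f x = x.
  have [Dx|nD] := pselect (D x); first by left; rewrite fD//; exact: pathD.
  have [[y Dy <-]|neD] := pselect (((e i).2 @` D) x).
    by left; rewrite feD//; apply: graphing_path_sym; exact: pathD.
  by right; exact: fE.
exists (aut_of f); split.
- apply: (@L1_full_group_bound _ (cst (e i).1%:R%:E)) => //.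
  + by move=> x; rewrite lee_fin.
  + by rewrite integral_cst//= probability_setT mule1 ltry.
  + apply: filterS fK => x /(_ Logic.I) ->; apply/orbit_relP.
    by have [px|->] := pathf x; [exists (e i).1|exists 0%N].
  + apply: filterS fK => x /(_ Logic.I) ->.
    have [px|->] := pathf x; first exact: graphing_dist_le.
    by rewrite graphing_distxx lee_fin.
- apply: eq_aut; have f2 := ae_aut (aut_of f) fK.
  apply: filterS2 (filterI (ae_mulE (aut_of f) (aut_of f)) (ae_oneE mu)) (filterI fK f2).
  by move=> x [-> ->] [/(_ Logic.I) h1 /(_ Logic.I)]; rewrite h1 => ->; exact: ff.
- by apply: filterS fK => x /(_ Logic.I) -> /fD.
- apply: filterS fK => x /(_ Logic.I) ->; split=> [[y Dy]|Dx]; last first.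
    by exists x => //; rewrite fD.
  have [//|nD] := pselect (D x).
  have [[z Dz <-]|neD] := pselect (((e i).2 @` D) x).
    by rewrite feD// => /eD; case.
  by rewrite fE// => yx; exfalso; apply: neD; exists y.
- apply: filterS fK => x /(_ Logic.I) fx; apply: contra_notP => /not_orP[nD neD].
  by rewrite fx fE.
Qed.

Lemma measurable_hit i B : measurable B ->
  measurable (dom (e i).2 `&` (e i).2 @^-1` B).
Proof. exact: measurable_dom_preimage. Qed.

(** These points form the saturation of [B], a set that is measurable because
    there are countably many words. *)
Lemma ergodic_hit B : ergodic Phi -> measurable B -> nonnull mu B ->
  \forall x \ae mu, exists i, dom (e i).2 x /\ B ((e i).2 x).
Proof.
move=> erg mB nB; pose sat := \bigcup_i (dom (e i).2 `&` (e i).2 @^-1` B).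
have msat : measurable sat by apply: bigcupT_measurable => i; exact: measurable_hit.
have satP x : sat x <-> exists2 y, B y & orbit_rel Phi x y.
  split=> [[i _ [ex Bx]]|[y By /orbit_relP[n /eP[i _ [ex exy]]]]].
    by exists ((e i).2 x) => //; apply/orbit_relP; exists (e i).1; apply/eP; exists i.
  by exists i => //; split=> //=; rewrite exy.
have [|sat0|sat1] := erg sat msat.
- exists sat; split; last exact: aeW.
  move=> x y xy /satP[z Bz xz]; apply/satP; exists z => //.
  by apply: rst_trans xz; exact: rst_sym.
- exfalso; apply: nB; exists sat; split=> // x /= /contrapT Bx.
  by apply/satP; exists x => //; exact: rst_refl.
have : \forall x \ae mu, sat x.
  exists (~` sat); split=> //; first exact: measurableC.
  by rewrite probability_setC// sat1 subee.
by apply: filterS => x [i _ h]; exists i.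
Qed.

(** A word carrying a nonnull part of [C] minus [B] into [B] takes this part off
    itself, and can be turned into an involution. *)
Lemma L1_full_group_many C : nonatomic mu -> ergodic Phi ->
  measurable C -> nonnull mu C ->
  exists p, [/\ G p, (p * p = 1)%g, supp p `<=[mu] C & p <> 1%g].
Proof.
move=> natom erg mC nC.
have [B [mB BC B0 BltC]] := natom C mC (nonnull_gt0 mC nC).
have nCB : nonnull mu (C `\` B).
  move=> h; move: BltC; apply/negP; rewrite -leNgt; apply: measure_ae_le => //.
  apply: filterS h => x h Cx; apply: contrapT => nB; exact: h.
pose D i := (C `\` B) `&` (dom (e i).2 `&` (e i).2 @^-1` B).
have [i nD] : exists i, nonnull mu (D i).
  apply: nonnull_exists.
  apply: nonnullS (nonnull_ae nCB (ergodic_hit erg mB (gt0_nonnull mB B0))).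
  by move=> x [CBx /= [i ex]]; exists i.
have mD : measurable (D i).
  by apply: measurableI; [exact: measurableD|exact: measurable_hit].
have [|||t [Gt tt tD _ tsupp]] := @L1_full_group_swap i (D i).
- exact: mD.
- by move=> x [_ []].
- by move=> x y [_ [_ Bx]] [[_ nB] _] exy; apply: nB; rewrite -exy.
exists t; split=> //.
  apply: filterS tsupp => x h /h[[[]//]|[y [_ [_ By]] <-]].
  exact: BC.
move=> t1; apply: nD; apply: filterS2 tD (ae_oneE mu) => x + x1 Dx.
move=> /(_ Dx); rewrite t1 x1 => xe; case: Dx => [[_ nB] [_]] /=.
by rewrite -xe.
Qed.

Lemma L1_full_group_rich : nonatomic mu -> ergodic Phi -> rich G.
Proof.
move=> natom erg; split.
- exact: L1_full_group_subgroup.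
- exact: L1_full_group_cut.
- by move=> C mC nC; exact: L1_full_group_many.
Qed.

End L1_full_group.

(** * Uniqueness of the invariant measure *)

Section compare_measures.
Context (R : realType) (d : measure_display) (X : measurableType d).
Context (mu : probability X R).
Implicit Types (A B C D P N : set X) (T : Aut mu).

Lemma hahn_compare (nu : probability X R) : exists P N,
  [/\ measurable P, measurable N, P `|` N = setT /\ P `&` N = set0,
    (forall A, measurable A -> A `<=` P -> mu A <= nu A) &
    (forall A, measurable A -> A `<=` N -> nu A <= mu A)].
Proof.
pose kappa : {charge set X -> \bar R} :=
  cadd (charge_of_finite_measure nu) (copp (charge_of_finite_measure mu)).
have kappaE A : kappa A = nu A - mu A by [].
have [P [N [[mP hP] [mN hN] PN PN0]]] := Hahn_decomposition kappa.
exists P, N; split=> // A mA.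
  by move=> /(hP _ mA); rewrite kappaE sube_ge0// fin_num_measure.
by move=> /(hN _ mA); rewrite kappaE sube_le0.
Qed.

(** Let [P] and [N] be the parts where [nu] and [mu] dominate.  Unless [N] is
    null, countably many words carry the pieces of any subset of [P] into [N].
    The involution swapping a piece [C] with its image preserves both measures,
    so [nu C <= mu C]; hence [nu <= mu] on [P] as well as on [N], and
    probabilities comparable in this way are equal. *)
Lemma ergodic_invariant_measure (Phi : graphing mu) (nu : probability X R)
    (E : nat -> set X) :
  separating E -> ergodic Phi ->
  (forall A, measurable A -> (\forall x \ae mu, ~ A x) -> nu A = 0) ->
  (forall T A, L1_full_group Phi T -> measurable A -> nu (T @^-1` A) = nu A) ->
  forall A, measurable A -> nu A = mu A.
Proof.
move=> sepE erg ac inv.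
have nu_ae_le A B : measurable A -> measurable B -> A `<=[mu] B -> nu A <= nu B.
  move=> mA mB AB; have mD : measurable (A `\` B) by exact: measurableD.
  apply: measure_ae_le => //; exists (A `\` B); split=> //.
    by apply: ac => //; apply: filterS AB => x AB [Ax nB]; exact/nB/AB.
  by move=> x /= /not_implyP.
have nu_ae_eq A B : measurable A -> measurable B ->
    (\forall x \ae mu, A x <-> B x) -> nu A = nu B.
  move=> mA mB AB; apply/eqP; rewrite eq_le.
  by rewrite !nu_ae_le//; apply: filterS AB => x [].
have compl_le A : measurable A -> mu (~` A) <= nu (~` A) -> nu A <= mu A.
  move=> mA; rewrite !probability_setC//.
  by rewrite leeD2lE// leeN2.
have [P [N [mP mN [PN PN0] hP hN]]] := hahn_compare nu.
have [e eP] := words_countable Phi.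
have le_P B : measurable B -> B `<=` P -> nu B <= mu B.
  move=> mB BP; have [nN|/not_nonnull N0] := pselect (nonnull mu N); last first.
    apply: compl_le => //.
    have mPB : measurable (P `\` B) by exact: measurableD.
    have mu_le : mu (~` B) <= mu (P `\` B).
      apply: measure_ae_le => //; first exact: measurableC.
      apply: filterS N0 => x nNx nB; split=> //.
      by have [] : (P `|` N) x by rewrite PN.
    apply: le_trans mu_le _; apply: le_trans (hP _ mPB (@subDsetl _ _ _)) _.
    by apply: le_measure; rewrite ?inE//; exact: measurableC.
  pose F i := B `&` (dom (e i).2 `&` (e i).2 @^-1` N).
  have mF i : measurable (F i) by apply: measurableI => //; exact: measurable_hit.
  have le_F i C : measurable C -> C `<=` F i -> nu C <= mu C.
    move=> mC CF.
    have Ce : C `<=` dom (e i).2 by move=> x /CF[_ []].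
    have eC x y : C x -> C y -> (e i).2 x <> y.
      move=> /CF[_ [_ Nx]] /CF[/BP Py _] exy.
      suff : (P `&` N) y by rewrite PN0.
      by split=> //; rewrite -exy.
    have [t [Gt _ _ tC _]] := L1_full_group_swap sepE eP mC Ce eC.
    have meC : measurable ((e i).2 @` C) by exact: measurable_pfun_image.
    have -> : nu C = nu ((e i).2 @` C).
      rewrite -(inv t _ Gt meC); apply: nu_ae_eq => //.
        exact: measurable_aut_preimage.
      by apply: filterS tC => x [h1 h2]; split.
    rewrite -(pfun_preserving mC Ce); apply: hN => //.
    by move=> _ [x /CF[_ [_ Nx]] <-].
  have mU : measurable (\bigcup_i F i) by exact: bigcupT_measurable.
  have BU : B `<=[mu] \bigcup_i F i.
    by apply: filterS (ergodic_hit eP erg mN nN) => x [i h] Bx; exists i.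
  apply: le_trans (nu_ae_le _ _ mB mU BU) _.
  have UB : \bigcup_i F i `<=` B by move=> x [i _ []].
  apply: le_trans (_ : mu (\bigcup_i F i) <= _); last first.
    by apply: le_measure; rewrite ?inE.
  have mD := seqDU_measurable mF.
  rewrite seqDU_bigcup_eq !measure_bigcup//.
  apply: lee_nneseries => // i _; apply: (le_F i) => //; exact: subset_seqDU.
move=> A mA.
have le_all C : measurable C -> nu C <= mu C.
  move=> mC; rewrite (measureDI nu mC mP) (measureDI mu mC mP) leeD//.
    apply: hN; first exact: measurableD.
    by move=> x [_ nP]; have [] : (P `|` N) x by rewrite PN.
  by apply: le_P; [exact: measurableI|move=> x []].
apply/eqP; rewrite eq_le le_all//=.
have := le_all _ (measurableC mA); rewrite !probability_setC//.
by rewrite leeD2lE// leeN2.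
Qed.


End compare_measures.

(** * Assembling the conjugacy *)

Section reconstruction.
Context (R : realType) (d : measure_display) (X : measurableType d).
Context (mu : probability X R) (X_standard : standard_borel R X).
Implicit Types (A B C D : set X) (T : Aut mu) (G H : set (Aut mu)).
Context (E : nat -> set X) (sepE : separating E).

Lemma ae_eq_separating (f g : X -> X) :
  (forall n, \forall x \ae mu, E n (f x) <-> E n (g x)) ->
  \forall x \ae mu, f x = g x.
Proof.
move=> /ae_foralln h; apply: filterS h => x h; apply: contrapT => fg.
by have [n [fx gx]] := sepE.2 _ _ fg; apply: gx; apply/h.
Qed.

(** A point map inducing the map of measure algebras of [corresponds]; it is
    nonsingular because null sets correspond to null sets. *)
Lemma corresponds_realization G H (psi : Aut mu -> Aut mu) :
  rich G -> rich H -> group_isomorphism G H psi ->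
  exists Q : X -> X, [/\ measurable_fun setT Q,
    forall A B, measurable A -> measurable B -> corresponds G psi A B ->
      \forall x \ae mu, A (Q x) <-> B x &
    forall P : X -> Prop, (\forall x \ae mu, P x) -> \forall x \ae mu, P (Q x)].
Proof.
move=> richG richH psi_iso.
have relT : corresponds G psi setT setT.
  move=> p Gp pp; split=> [_|h]; first exact: aeW.
  suff -> : p = 1%g.
    by rewrite (iso1 (rich_subgroup richG) psi_iso); exact: supp1.
  by apply: supp_eq1; apply; apply: filterS h => x h /h; apply.
have [Q mQ QP] := point_realization X_standard
  (corresponds_total sepE richG richH psi_iso) relT
  (@correspondsC _ _ _ _ G psi) (corresponds_bigcup sepE richG richH psi_iso)
  (corresponds_le sepE richG richH psi_iso).
exists Q; split=> // P [N [mN N0 NP]].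
have nN : \forall x \ae mu, ~ N x by exists N; split=> // x /= /contrapT.
have rel0 : corresponds G psi set0 set0.
  by rewrite -setCT; exact: correspondsC.
have relN : corresponds G psi N set0.
  apply: corresponds_ae rel0; first exact: aeW.
  by apply: filterS nN.
apply: filterS (QP _ _ mN measurable0 relN) => x [h _].
by apply: contrapT => nP; apply/h/NP.
Qed.

End reconstruction.

Theorem corollary3p19 (R : realType) (d : measure_display)
    (X : measurableType d) (mu : probability X R)
    (X_standard : standard_borel R X) (mu_nonatomic : nonatomic mu)
    (Phi Psi : graphing mu) (Phi_ergodic : ergodic Phi)
    (Psi_ergodic : ergodic Psi)
    (psi : Aut mu -> Aut mu)
    (psi_iso : group_isomorphism (L1_full_group Phi) (L1_full_group Psi) psi) :
  exists S : Aut mu,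
    forall T : Aut mu, L1_full_group Phi T -> psi T = (S * T * S^-1)%g.
Proof.
have [E sepE] := standard_borel_separating mu X_standard.
have [e eP] := words_countable Phi; have [e' eP'] := words_countable Psi.
have richG := L1_full_group_rich sepE eP mu_nonatomic Phi_ergodic.
have richH := L1_full_group_rich sepE eP' mu_nonatomic Psi_ergodic.
have [phi phi_iso phiK] := inverse_iso richG psi_iso.
(* Preimages under [Q] carry [A] to its image in the measure algebra, so [Q] is
   the inverse of the conjugating map [S]. *)
have [Q [mQ QP aeQ]] := corresponds_realization X_standard sepE richG richH psi_iso.
have [S [mS SP aeS]] := corresponds_realization X_standard sepE richH richG phi_iso.
have total := corresponds_total sepE richG richH psi_iso.
have total' := corresponds_total sepE richH richG phi_iso.
have relV A B : measurable A -> measurable B ->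
    corresponds (L1_full_group Phi) psi A B ->
    corresponds (L1_full_group Psi) phi B A.
  exact: (corresponds_inv sepE richG richH psi_iso phi_iso phiK).
have QS : \forall x \ae mu, Q (S x) = x.
  apply: (ae_eq_separating sepE) => n; have mE := sepE.1 n.
  have [B mB EB] := total _ mE.
  apply: filterS2 (aeS _ (QP _ _ mE mB EB)) (SP _ _ mB mE (relV _ _ mE mB EB)).
  by move=> x -> ->.
have psiK h : L1_full_group Psi h -> psi (phi h) = h.
  by move=> Hh; have [f Gf <-] := iso_surj psi_iso Hh; rewrite phiK.
have SQ : \forall x \ae mu, S (Q x) = x.
  apply: (ae_eq_separating sepE) => n; have mE := sepE.1 n.
  have [A mA EA] := total' _ mE.
  have AE := corresponds_inv sepE richH richG phi_iso psi_iso psiK mE mA EA.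
  apply: filterS2 (aeQ _ (SP _ _ mE mA EA)) (QP _ _ mA mE AE).
  by move=> x -> ->.
have mQ_pre A : measurable A -> measurable (Q @^-1` A).
  exact: measurable_preimageT.
pose mfunQ := isMeasurableFun.Build _ _ _ _ _ mQ.
pose fQ : {mfun X >-> X} := HB.pack Q mfunQ.
have muQ A : measurable A -> mu (Q @^-1` A) = mu A.
  apply: (@ergodic_invariant_measure _ _ _ mu Phi (distribution mu fQ) E) => //.
    move=> C mC C0; have nQC := aeQ _ C0.
    apply: (@measure_negligible _ _ _ mu (Q @^-1` C)); first exact: mQ_pre.
    by apply: negligibleS nQC => x Cx; apply.
  move=> T C GT mC; have [B mB CB] := total _ mC.
  have TCB := corresponds_preimage richG psi_iso GT CB.
  have mTC := measurable_aut_preimage T mC.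
  have mTB := measurable_aut_preimage (psi T) mB.
  transitivity (mu (psi T @^-1` B)).
    exact: (measure_ae_eq (mQ_pre _ mTC) mTB (QP _ _ mTC mTB TCB)).
  transitivity (mu B); first exact: (mp_preserving (repr (psi T)) mB).
  by symmetry; exact: (measure_ae_eq (mQ_pre _ mC) mB (QP _ _ mC mB CB)).
have [f [fQE fSE]] := almost_bijection sepE mQ mS SQ QS aeS muQ.
exists (aut_of f)^-1%g => T GT; rewrite invgK.
have fE : \forall x \ae mu, aut_of f x = Q x.
  by apply: filterS2 (aut_ofK f) fQE => x /(_ Logic.I) -> ->.
suff fT : (aut_of f * psi T = T * aut_of f)%g by rewrite -mulgA -fT mulKg.
apply: eq_aut.
(* Equivariance, read off on the separating sets. *)
have step : \forall x \ae mu, Q (psi T x) = T (Q x).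
  apply: (ae_eq_separating sepE) => n; have mE := sepE.1 n.
  have [B mB EB] := total _ mE.
  have TEB := corresponds_preimage richG psi_iso GT EB.
  have mTE := measurable_aut_preimage T mE.
  have mTB := measurable_aut_preimage (psi T) mB.
  apply: filterS2 (ae_aut (psi T) (QP _ _ mE mB EB)) (QP _ _ mTE mTB TEB).
  by move=> x h1 h2; exact: iff_trans h1 (iff_sym h2).
apply: filterS3 step (filterI (ae_mulE (aut_of f) (psi T)) (ae_mulE T (aut_of f)))
  (filterI fE (ae_aut (psi T) fE)).
by move=> x Qx [-> ->] [-> ->].
Qed.
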